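(* Let $d\ge 2$ be an integer, and let $(T_n,v_n)$, $n\ge 0$, be the rooted finite Cayley trees of down-degree $d$. The activity-locus of the family $\{(T_n,v_n)\}_{n\ge 0}$, i.e. the set of $\lambda_0\in\mathbb{C}$ at which the family $\{R_{T_n,v_n}\}_{n\ge 0}$ is not normal, equals the set of accumulation points in $\mathbb{C}$ of the zeros of the collection of polynomials $\{Z_{T_n}\}_{n\ge 0}$.
   Context: The Cayley tree $T_n$ of depth $n$ and down-degree $d$ is the finite tree with root $v_n$ in which every leaf is at distance $n$ from the root and every non-leaf has exactly $d$ children ($T_0$ is a single vertex). For a finite simple graph $G$, $Z_G(\lambda)=\sum_I\lambda^{|I|}$, summed over independent sets $I$ of $G$. For a rooted graph $(G,v)$, $Z^{\mathrm{in}}_{G,v}$ (resp. $Z^{\mathrm{out}}_{G,v}$) is the same sum restricted to independent sets containing (resp. not containing) $v$, and $R_{G,v}=Z^{\mathrm{in}}_{G,v}/Z^{\mathrm{out}}_{G,v}$ is the occupation ratio, a rational function of $\lambda$ viewed as a holomorphic map to the Riemann sphere $\widehat{\mathbb{C}}$. A family of holomorphic maps to $\widehat{\mathbb{C}}$ is normal at $\lambda_0$ if there is an open neighborhood of $\lambda_0$ on which every sequence of the family has a subsequence converging locally uniformly (spherical metric). *)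

(* Defs.v *)
From HB Require Import structures.
From mathcomp Require Import all_boot all_order all_algebra.
From mathcomp Require Import complex.
From mathcomp Require Import all_classical all_reals all_analysis.

Set Implicit Arguments.
Unset Strict Implicit.
Unset Printing Implicit Defensive.

Import Order.TTheory GRing.Theory Num.Theory.
Import numFieldNormedType.Exports.

Local Open Scope classical_set_scope.
Local Open Scope ring_scope.

Record sgraph := SGraph {
  vertex :> finType;
  adj : rel vertex;
  adj_sym : symmetric adj;
  adj_irrefl : irreflexive adj }.

Record rooted_graph := RootedGraph {
  rgraph :> sgraph;
  rt : rgraph }.

Definition independent (G : sgraph) (I : {set G}) : bool :=
  [forall x in I, forall y in I, ~~ adj x y].

Definition indep_poly (K : nzRingType) (G : sgraph) : {poly K} :=
  \sum_(I : {set G} | independent I) 'X^#|I|.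

Definition indep_poly_in (K : nzRingType) (G : rooted_graph) : {poly K} :=
  \sum_(I : {set G} | independent I && (rt G \in I)) 'X^#|I|.

Definition indep_poly_out (K : nzRingType) (G : rooted_graph) : {poly K} :=
  \sum_(I : {set G} | independent I && (rt G \notin I)) 'X^#|I|.

(* A vertex is a word of length at most n over 'I_d: the empty word is the
   root, and the children of a word of length < n are its d extensions by one
   letter; the words of length n are the leaves. *)
Section CayleyTree.
Variables d n : nat.

Definition is_child (s t : n.-bseq 'I_d) : bool :=
  [exists i : 'I_d, val t == rcons (val s) i].

Definition cayley_adj (s t : n.-bseq 'I_d) : bool :=
  is_child s t || is_child t s.

Lemma cayley_adj_sym : symmetric cayley_adj.
Proof. by move=> s t; rewrite /cayley_adj orbC. Qed.

Lemma cayley_adj_irrefl : irreflexive cayley_adj.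
Proof.
move=> s; rewrite /cayley_adj orbb; apply/existsP => -[i /eqP].
by move/(congr1 size); rewrite size_rcons => /n_Sn.
Qed.

Definition cayley_tree : rooted_graph :=
  @RootedGraph (SGraph cayley_adj_sym cayley_adj_irrefl) [bseq].

End CayleyTree.

Section Sphere.
Variable R : realType.

(* R[i] as a numFieldType, which carries the topology of the modulus. *)
Definition C : numFieldType := R[i].

(* The Riemann sphere, None being the point at infinity. *)
Definition sphere := option C.

Definition modulus (z : C) : R := ComplexField.Normc.normc z.

(* Half the chord between the stereographic images on the unit sphere. *)
Definition half_chord (x y : sphere) : R :=
  match x, y with
  | Some z, Some w => modulus (z - w) /
      (Num.sqrt (1 + modulus z ^+ 2) * Num.sqrt (1 + modulus w ^+ 2))
  | Some z, None | None, Some z => (Num.sqrt (1 + modulus z ^+ 2))^-1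
  | None, None => 0
  end.

(* Great-circle distance: the geodesic distance of 2|dz|/(1+|z|^2). *)
Definition spherical_dist (x y : sphere) : R := 2 * asin (half_chord x y).

(* The rational function p/q as a map to the sphere: common factors have to be
   cancelled before evaluating. *)
Definition rational_map (p q : {poly C}) (z : C) : sphere :=
  let g := gcdp p q in
  if (q %/ g).[z] == 0 then None else Some ((p %/ g).[z] / (q %/ g).[z]).

Definition occupation_ratio (G : rooted_graph) : C -> sphere :=
  rational_map (indep_poly_in C G) (indep_poly_out C G).

Definition cvg_locally_uniformly (U : set C)
    (f : nat -> C -> sphere) (g : C -> sphere) : Prop :=
  forall z, U z -> exists2 N : set C, nbhs z N &
    forall e : R, 0 < e -> \forall k \near \oo,
      forall w, U w -> N w -> spherical_dist (f k w) (g w) < e.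

Definition normal_at (F : set (C -> sphere)) (z0 : C) : Prop :=
  exists U : set C, [/\ open U, U z0 &
    forall f : nat -> C -> sphere, (forall k, F (f k)) ->
    exists phi : nat -> nat, {homo phi : m n / (m < n)%N} /\
    exists g : C -> sphere, cvg_locally_uniformly U (f \o phi) g].

Definition activity_locus (J : Type) (G : J -> rooted_graph) : set C :=
  [set z0 | ~ normal_at (range (fun j => occupation_ratio (G j))) z0].

End Sphere.

Arguments activity_locus R {J} G.

(* Main.v *)
(* The ratios satisfy R_0 = z and R_(n+1) = z / (1 + R_n)^d, and the zeros of the
   independence polynomials are the z with R_n(z) = -1.

   If z0 is not an accumulation point of zeros, then near any point w0 close to
   z0 the ratios omit 0, -1 and oo, except possibly at w0.  Write R_n = a / b,
   c = - (a + b) and W = a' b - a b'.  The metric of density sigma,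
     sigma^2 = |W|^2 (|a|^(1/2) + |b|^(1/2) + |c|^(1/2)) / |a b c|^(3/2),
   has curvature at most -1/72, because W is up to sign the Wronskian of any two
   of a, b, c.  The substitution w0 + z^8 makes sigma vanish at z = 0, so Ahlfors'
   form of the Schwarz lemma bounds it on a disc, independently of n.  As sigma
   dominates the spherical derivative up to a constant, the family is
   equicontinuous, and normality follows by an Ascoli argument.

   Conversely, suppose that the family is normal, hence equicontinuous, near an
   accumulation point of zeros.  Take two nearby zeros mu and nu such that the
   period N + 3 of the orbit of 0 at mu is not a period at nu.  Along an
   arithmetic progression R_n(nu) = -1, so R_n and R_(n+N+3) are bounded on a
   fixed disc; their difference vanishes at mu to an order tending to infinity,
   hence tends to 0 at nu by the maximum principle, but there it is a nonzero
   constant.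

   All Laplacian computations are made through second-order expansions
     u(z + h) = u(z) + Re(a h + b h^2) + c |h|^2 + o(|h|^2),
   where 4 c plays the role of the Laplacian, so that c <= 0 at a maximum. *)

Require Import Defs.
From mathcomp Require Import all_boot all_order all_algebra.
From mathcomp Require Import complex.
From mathcomp Require Import all_classical all_reals all_analysis.
From mathcomp Require Import ring lra zify.

Set Implicit Arguments.
Unset Strict Implicit.
Unset Printing Implicit Defensive.

Import Order.TTheory GRing.Theory Num.Theory.
Import numFieldNormedType.Exports.

Local Open Scope classical_set_scope.
Local Open Scope ring_scope.

(** * The complex plane *)

Section Modulus.
Variable R : realType.
Implicit Types z w : C R.

Lemma modulus_sqr z : modulus z ^+ 2 = complex.Re z ^+ 2 + complex.Im z ^+ 2.
Proof.
by case: z => a b; rewrite /modulus /= sqr_sqrtr // addr_ge0 // sqr_ge0.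
Qed.

Lemma modulus_ge0 z : 0 <= modulus z.
Proof. by case: z => a b; rewrite sqrtr_ge0. Qed.

Lemma modulus0 : modulus (0 : C R) = 0.
Proof. exact: ComplexField.Normc.normc0. Qed.

Lemma modulus1 : modulus (1 : C R) = 1.
Proof. exact: ComplexField.Normc.normc1. Qed.

Lemma modulusM z w : modulus (z * w) = modulus z * modulus w.
Proof. exact: ComplexField.Normc.normcM. Qed.

Lemma modulusV z : modulus z^-1 = (modulus z)^-1.
Proof. exact: ComplexField.Normc.normcV. Qed.

Lemma modulusN z : modulus (- z) = modulus z.
Proof. by case: z => a b; rewrite /modulus /= !sqrrN. Qed.

Lemma modulusB z w : modulus (z - w) = modulus (w - z).
Proof. by rewrite -opprB modulusN. Qed.

Lemma modulusX z n : modulus (z ^+ n) = modulus z ^+ n.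
Proof. by elim: n => [|n IH]; rewrite ?modulus1 // !exprS modulusM IH. Qed.

Lemma modulus_eq0 z : (modulus z == 0) = (z == 0).
Proof.
apply/eqP/eqP => [/ComplexField.Normc.eq0_normc //|->]; exact: modulus0.
Qed.

Lemma modulus_gt0 z : (0 < modulus z) = (z != 0).
Proof. by rewrite lt_def modulus_ge0 andbT modulus_eq0. Qed.

Lemma normC_modulus z : `|z| = (real_complex R (modulus z) : C R).
Proof. by []. Qed.

Lemma modulusD z w : modulus (z + w) <= modulus z + modulus w.
Proof. by have := ler_normD z w; rewrite !normC_modulus -rmorphD /= lecR. Qed.

Lemma modulus_distD z w v : modulus (z - v) <= modulus (z - w) + modulus (w - v).
Proof. by rewrite -[z - v](subrKA w) modulusD. Qed.

Lemma modulus_real (x : R) : modulus (real_complex R x : C R) = `|x|.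
Proof. by rewrite /modulus /= expr0n /= addr0 sqrtr_sqr. Qed.

Lemma Re_modulus z : `|complex.Re z| <= modulus z.
Proof.
rewrite -(@ler_pXn2r _ 2) ?nnegrE ?normr_ge0 ?modulus_ge0 //.
by rewrite real_normK ?num_real // modulus_sqr lerDl sqr_ge0.
Qed.

Lemma Im_modulus z : `|complex.Im z| <= modulus z.
Proof.
rewrite -(@ler_pXn2r _ 2) ?nnegrE ?normr_ge0 ?modulus_ge0 //.
by rewrite real_normK ?num_real // modulus_sqr lerDr sqr_ge0.
Qed.

Lemma modulus_ReIm z : modulus z <= `|complex.Re z| + `|complex.Im z|.
Proof.
rewrite -(@ler_pXn2r _ 2) ?nnegrE ?addr_ge0 ?normr_ge0 ?modulus_ge0 //.
rewrite modulus_sqr sqrrD !real_normK ?num_real //.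
have := mulr_ge0 (normr_ge0 (complex.Re z)) (normr_ge0 (complex.Im z)).
by lra.
Qed.

(** The radii of the metric balls of [C R] are themselves elements of [C R]. Being positive forces
    them to be real, so the real part serves as radius. *)
Lemma nbhs_modulusP z (N : set (C R)) :
  nbhs z N <-> exists2 e : R, 0 < e & forall w, modulus (w - z) < e -> N w.
Proof.
split.
  case/nbhs_normP => e /= e0 eN.
  have [Ie Re0] : complex.Im e = 0 /\ 0 < complex.Re e.
    by move: e0; rewrite ltcE /= => /andP[/eqP].
  exists (complex.Re e) => // w wz; apply: eN.
  rewrite /ball_ /= distrC normC_modulus ltcE /= Ie eqxx /=.
  exact: wz.
case=> e e0 eN; apply/nbhs_normP; exists (real_complex R e) => /=.
  by rewrite ltcR.
by move=> w; rewrite /ball_ /= distrC normC_modulus ltcR; exact: eN.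
Qed.

Definition cball z (r : R) : set (C R) := [set w | modulus (w - z) < r].

Definition cdisc z (r : R) : set (C R) := [set w | modulus (w - z) <= r].

Lemma nbhs_cball z r : 0 < r -> nbhs z (cball z r).
Proof. by move=> r0; apply/nbhs_modulusP; exists r. Qed.

Lemma open_cball z r : open (cball z r).
Proof.
rewrite openE => w /= wr; rewrite /interior; apply/nbhs_modulusP.
exists (r - modulus (w - z)); first by rewrite subr_gt0.
move=> v vw; rewrite /cball /=; apply: le_lt_trans (modulus_distD v w z) _.
by rewrite -ltrBrDr.
Qed.

Lemma modulus_sub_abs z w : `|modulus z - modulus w| <= modulus (z - w).
Proof.
have h1 := modulusD (z - w) w; have h2 := modulusD (w - z) z.
move: h1 h2; rewrite !subrK (modulusB w z) => h1 h2.
by rewrite ler_norml; apply/andP; split; lra.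
Qed.

Lemma continuous_modulusP (u : C R -> R) z :
  {for z, continuous u} <-> forall e : R, 0 < e ->
    exists2 r : R, 0 < r & forall w, modulus (w - z) < r -> `|u w - u z| < e.
Proof.
split=> [uz e e0|H].
  have /nbhs_modulusP[r r0 rP] := uz _ (nbhsx_ballx (u z) e e0).
  by exists r => // w /rP; rewrite /ball /= distrC.
move=> N /nbhs_ballP[e e0 eN]; have [r r0 rP] := H e e0.
by apply/nbhs_modulusP; exists r => // w /rP wr; apply: eN; rewrite /ball /= distrC.
Qed.

Lemma continuous_modulusB z : continuous (fun w => modulus (w - z)).
Proof.
move=> w; apply/continuous_modulusP => e e0; exists e => // v vw.
apply: le_lt_trans (modulus_sub_abs _ _) _.
by rewrite opprB addrA subrK.
Qed.

(** The disc is a closed part of a continuous image of a compact square of real coordinates. *)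
Lemma compact_cdisc z r : compact (cdisc z r).
Proof.
pose f (p : R * R) : C R := z + Complex p.1 p.2.
have fc : continuous f.
  move=> p /= N /nbhs_modulusP[e e0 eN].
  have e2 : 0 < e / 2 by lra.
  exists (ball p.1 (e/2), ball p.2 (e/2)) => /=.
    by split; apply: nbhsx_ballx.
  move=> q [/= q1 q2]; apply: eN; rewrite /f opprD addrACA subrr add0r.
  apply: le_lt_trans (modulus_ReIm _) _ => /=.
  move: q1 q2; rewrite /ball /= distrC => q1; rewrite distrC => q2.
  by lra.
apply: (@subclosed_compact _ _ (f @` (`[- r, r] `*` `[-r, r]))).
- have -> : cdisc z r = (fun w => modulus (w - z)) @^-1` [set x | x <= r] by [].
  apply: preimage_closed; last exact: closed_le.
  by move=> w _; apply: continuous_modulusB.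
- apply: continuous_compact; first exact: continuous_subspaceT.
  by apply: compact_setX; apply: segment_compact.
- move=> w; rewrite /cdisc /= => wr; exists (complex.Re (w - z), complex.Im (w - z)).
    by split => /=; rewrite in_itv /= -ler_norml (le_trans _ wr) ?Re_modulus ?Im_modulus.
  have E : forall v : C R, Complex (complex.Re v) (complex.Im v) = v by case.
  by rewrite /f /= E addrC subrK.
Qed.

End Modulus.

(** * Second-order expansions *)

Section SecondOrder.
Variable R : realType.
Implicit Types (z w h a b : C R) (u v : C R -> R) (p q : {poly C R}).

Local Notation re := (@complex.Re R).

(** For smooth [u], [a] is twice the Wirtinger derivative at [z] and [c] a quarter of the Laplacian.
    The harmonic coefficient [b] is existential because no later estimate refers to its value. *)
Definition expansion2 u z a (c : R) := exists b, forall e : R, 0 < e ->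
  exists2 r : R, 0 < r & forall h, modulus h < r ->
    `|u (z + h) - u z - (re (a * h) + re (b * h ^+ 2) + c * modulus h ^+ 2)|
      <= e * modulus h ^+ 2.

Lemma ReD (x y : C R) : re (x + y) = re x + re y.
Proof. by case: x; case: y. Qed.

Lemma ReZ (k : R) (x : C R) : re (real_complex R k * x) = k * re x.
Proof. by case: x => a b /=; rewrite mul0r subr0. Qed.

Lemma Re_mul_modulus (x y : C R) : `|re (x * y)| <= modulus x * modulus y.
Proof. by rewrite -modulusM Re_modulus. Qed.

Lemma modulus_conj (x : C R) : modulus (conjc x : C R) = modulus x.
Proof. by case: x => a b; rewrite /modulus /= sqrrN. Qed.

Lemma modulusD_sqr (x y : C R) : modulus (x + y) ^+ 2 =
  modulus x ^+ 2 + 2 * re ((conjc x : C R) * y) + modulus y ^+ 2.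
Proof. by rewrite !modulus_sqr; case: x => a b; case: y => c d /=; ring. Qed.

Lemma Re_sqr (x : C R) : re x ^+ 2 = (modulus x ^+ 2 + re (x ^+ 2)) / 2.
Proof. by rewrite modulus_sqr; case: x => a b /=; field. Qed.

Lemma expansion2_cst (k : R) z : expansion2 (fun=> k) z 0 0.
Proof.
exists 0 => e e0; exists 1 => // h _.
by rewrite !mul0r /= !addr0 !subrr normr0 mulr_ge0 ?exprn_ge0 ?modulus_ge0 ?ltW.
Qed.

Lemma expansion2D u v z a b (c d : R) : expansion2 u z a c -> expansion2 v z b d ->
  expansion2 (fun w => u w + v w) z (a + b) (c + d).
Proof.
move=> [a2 Hu] [b2 Hv]; exists (a2 + b2) => e e0.
have e2 : 0 < e / 2 by lra.
have [r r0 rP] := Hu _ e2; have [s s0 sP] := Hv _ e2.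
exists (Num.min r s); first by rewrite lt_min r0.
move=> h; rewrite lt_min => /andP[/rP h1 /sP h2].
rewrite !mulrDl !ReD.
have -> : e * modulus h ^+ 2 = e / 2 * modulus h ^+ 2 + e / 2 * modulus h ^+ 2 by field.
apply: le_trans (lerD h1 h2); apply: le_trans (ler_normD _ _).
by rewrite le_eqVlt; apply/orP; left; apply/eqP; congr (`|_|); ring.
Qed.

(** Chain rule, with [p1] and [2 * p2] in the role of the first two derivatives of [phi] at [u z].
    The square of Re(a h) is |a|^2 |h|^2 / 2 plus the harmonic term Re(a^2 h^2) / 2, whence the
    extra term in the new [c]. *)
Lemma expansion2_comp (phi : R -> R) (p1 p2 : R) u z a (c : R) :
  expansion2 u z a c ->
  (forall e : R, 0 < e -> exists2 r : R, 0 < r & forall t, `|t| < r ->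
    `|phi (u z + t) - phi (u z) - p1 * t - p2 * t ^+ 2| <= e * t ^+ 2) ->
  expansion2 (fun w => phi (u w)) z (real_complex R p1 * a)
    (p1 * c + p2 * modulus a ^+ 2 / 2).
Proof.
move=> [b Hu] Hphi.
exists (real_complex R p1 * b + real_complex R (p2 / 2) * a ^+ 2) => e e0.
pose A := modulus a; pose K := modulus b + `|c| + 1.
have A0 : 0 <= A by exact: modulus_ge0.
have K0 : 0 < K by rewrite /K; have := modulus_ge0 b; have := normr_ge0 c; lra.
have AK0 : 0 < A + K by lra.
have n1 := normr_ge0 p1; have n2 := normr_ge0 p2.
(* The error is shared in three: [e1] controls the remainder of [u], [e2] that of [phi], and the
   bound [e / D] on the radius pays for replacing t^2 by L^2, where L = Re(a h) is the linear part
   of the increment t. *)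
pose e1 := Num.min 1 (e / (3 * (`|p1| + 1))).
have e1_gt0 : 0 < e1 by rewrite lt_min ltr01 divr_gt0 //; lra.
pose e2 := e / (3 * (A + K) ^+ 2).
have e2_gt0 : 0 < e2 by rewrite divr_gt0 // mulr_gt0 ?exprn_gt0 //; lra.
have [r r0 rP] := Hu _ e1_gt0; have [s s0 sP] := Hphi _ e2_gt0.
pose D := 3 * (`|p2| * K * (2 * A + K) + 1).
have D0 : 0 < D.
  rewrite mulr_gt0 // ltr_wpDl // mulr_ge0 // ?mulr_ge0 //; lra.
exists (Num.min (Num.min r 1) (Num.min (s / (A + K)) (e / D))).
  by rewrite !lt_min r0 ltr01 !divr_gt0.
move=> h; rewrite !lt_min -!andbA => /and4P[hr h1 hs hD].
set H := modulus h in rP hr h1 hs hD *.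
have H0 : 0 <= H by exact: modulus_ge0.
have hp := rP _ hr; set t := u (z + h) - u z in hp.
set L := re (a * h) in hp *.
have LA : `|L| <= A * H by exact: Re_mul_modulus.
set B := re (b * h ^+ 2) in hp.
have BH : `|B| <= modulus b * H ^+ 2.
  by apply: le_trans (Re_mul_modulus _ _) _; rewrite modulusX.
rewrite -/H in hp; set rho := t - _ in hp.
have H2 : 0 <= H ^+ 2 by exact: exprn_ge0.
pose q := t - L.
have qE : q = B + c * H ^+ 2 + rho by rewrite /q /rho; ring.
have e1le : e1 <= 1 by rewrite ge_min lexx.
have qK : `|q| <= K * H ^+ 2.
  rewrite qE; apply: le_trans (ler_normD _ _) _.
  apply: le_trans (lerD (ler_normD _ _) hp) _.
  rewrite normrM (ger0_norm H2) /K.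
  have : e1 * H ^+ 2 <= 1 * H ^+ 2 by apply: ler_wpM2r.
  by lra.
have tAK : `|t| <= (A + K) * H.
  have -> : t = L + q by rewrite /q; ring.
  apply: le_trans (ler_normD _ _) _.
  have : K * H ^+ 2 <= K * H by apply: ler_wpM2l; [lra|rewrite expr2; apply: ler_piMl; lra].
  by lra.
have ts : `|t| < s.
  by apply: le_lt_trans tAK _; rewrite mulrC -ltr_pdivlMr.
have := sP _ ts; rewrite /t [u z + _]addrC subrK => pt; rewrite -/t in pt.
have t2 : t ^+ 2 <= (A + K) ^+ 2 * H ^+ 2.
  by rewrite -exprMn -real_normK ?num_real // lerXn2r ?nnegrE // mulr_ge0 // ltW.
have L2 : L ^+ 2 = (A ^+ 2 * H ^+ 2 + re (a ^+ 2 * h ^+ 2)) / 2.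
  by rewrite Re_sqr modulusM !exprMn.
have E3 : `|p2 * (q * (2 * L + q))| <= `|p2| * K * (2 * A + K) * H * H ^+ 2.
  rewrite !normrM -!mulrA; apply: ler_wpM2l => //.
  have -> : K * ((2 * A + K) * (H * H ^+ 2)) = (K * H ^+ 2) * ((2 * A + K) * H) by ring.
  apply: ler_pM => //.
  apply: le_trans (ler_normD _ _) _; rewrite normrM ger0_norm //.
  have : K * H ^+ 2 <= K * H by apply: ler_wpM2l; [lra|rewrite expr2; apply: ler_piMl; lra].
  by lra.
rewrite mulrDl ReD -(mulrA _ a h) -(mulrA _ b) -(mulrA _ (a ^+ 2)) !ReZ -/L -/B.
set X := phi _ - _ in pt *.
have -> : X - (p1 * L + (p1 * B + p2 / 2 * re (a ^+ 2 * h ^+ 2)) +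
    (p1 * c + p2 * modulus a ^+ 2 / 2) * H ^+ 2) =
   (X - p1 * t - p2 * t ^+ 2) + p1 * rho + p2 * (q * (2 * L + q)).
  have -> : re (a ^+ 2 * h ^+ 2) = 2 * L ^+ 2 - A ^+ 2 * H ^+ 2 by rewrite L2; field.
  by rewrite /rho /q -/A; field.
apply: le_trans (ler_normD _ _) _.
apply: le_trans (lerD (ler_normD _ _) (lexx _)) _.
rewrite normrM.
have F1 : e2 * t ^+ 2 <= e / 3 * H ^+ 2.
  apply: le_trans (ler_wpM2l (ltW e2_gt0) t2) _.
  rewrite mulrA; apply: ler_wpM2r => //; rewrite /e2 le_eqVlt; apply/orP; left; apply/eqP.
  by field; lra.
have F2 : `|p1| * `|rho| <= e / 3 * H ^+ 2.
  apply: le_trans (ler_wpM2l n1 hp) _; rewrite mulrA; apply: ler_wpM2r => //.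
  have : e1 <= e / (3 * (`|p1| + 1)) by rewrite ge_min lexx orbT.
  move=> /(ler_wpM2l n1) /le_trans; apply.
  rewrite mulrA ler_pdivrMr; last by lra.
  have -> : e / 3 * (3 * (`|p1| + 1)) = e * `|p1| + e by field.
  by rewrite mulrC; lra.
have F3 : `|p2| * K * (2 * A + K) * H * H ^+ 2 <= e / 3 * H ^+ 2.
  apply: ler_wpM2r => //.
  move: hD; rewrite ltr_pdivlMr // => hD.
  have : H * D = 3 * (`|p2| * K * (2 * A + K) * H) + 3 * H by rewrite /D; ring.
  by lra.
by lra.
Qed.

Lemma expansion2Z (k : R) u z a (c : R) : expansion2 u z a c ->
  expansion2 (fun w => k * u w) z (real_complex R k * a) (k * c).
Proof.
move=> Hu; have := @expansion2_comp ( *%R k) k 0 u z a c Hu.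
rewrite !mul0r addr0; apply=> e e0; exists 1 => // t _.
rewrite mulrDr [k * u z + _]addrC addrK subrr mul0r subrr normr0 mulr_ge0 ?sqr_ge0 //; lra.
Qed.

Lemma expansion2_continuous u z a (c : R) : expansion2 u z a c ->
  {for z, continuous u}.
Proof.
move=> [b Hu]; apply/continuous_modulusP => e e0.
have [r r0 rP] := Hu 1 ltr01.
pose K := modulus a + modulus b + `|c| + 1.
have K0 : 0 < K.
  by rewrite /K; have := modulus_ge0 a; have := modulus_ge0 b; have := normr_ge0 c; lra.
exists (Num.min (Num.min r 1) (e / K)); first by rewrite !lt_min r0 ltr01 divr_gt0.
move=> w; rewrite !lt_min -!andbA => /and3P[wr w1 we].
have := rP _ wr; rewrite [z + _]addrC subrK.
set h := w - z in wr w1 we *; set H := modulus h in wr w1 we *.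
have H0 : 0 <= H by exact: modulus_ge0.
have H2 : 0 <= H ^+ 2 by exact: exprn_ge0.
have H2H : H ^+ 2 <= H by rewrite expr2; apply: ler_piMl; lra.
have La : `|re (a * h)| <= modulus a * H by exact: Re_mul_modulus.
have Lb : `|re (b * h ^+ 2)| <= modulus b * H ^+ 2.
  by apply: le_trans (Re_mul_modulus _ _) _; rewrite modulusX.
set x := u w - u z; set y := _ + c * _; move=> xy.
have -> : x = (x - y) + y by ring.
apply: le_lt_trans (ler_normD _ _) _.
have yb : `|y| <= modulus a * H + modulus b * H + `|c| * H.
  apply: le_trans (ler_normD _ _) _; apply: lerD.
    apply: le_trans (ler_normD _ _) _; apply: lerD => //.
    by apply: le_trans Lb _; apply: ler_wpM2l => //; exact: modulus_ge0.
  by rewrite normrM (ger0_norm H2); apply: ler_wpM2l.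
have hK : H * K < e by rewrite -ltr_pdivlMr.
rewrite mul1r in xy; apply: le_lt_trans (lerD xy yb) _; apply: le_lt_trans hK.
have -> : H * K = H + (modulus a * H + modulus b * H + `|c| * H) by rewrite /K; ring.
by rewrite lerD2r.
Qed.

(* Averaging over h, -h, ih, -ih kills the harmonic part Re(ah + bh^2). *)
Lemma expansion2_max u z a (c : R) : expansion2 u z a c ->
  (exists2 r : R, 0 < r & forall h, modulus h < r -> u (z + h) <= u z) -> c <= 0.
Proof.
move=> [b Hu] [s s0 sP]; rewrite leNgt; apply/negP => c0.
have c2 : 0 < c / 2 by lra.
have [r r0 rP] := Hu _ c2.
pose k := Num.min r s / 2; have m0 : 0 < Num.min r s by rewrite lt_min r0.
have k0 : 0 < k by rewrite divr_gt0.
have kr : k < r by rewrite ltr_pdivrMr // (@le_lt_trans _ _ r) ?ge_min ?lexx //; lra.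
have ks : k < s by rewrite ltr_pdivrMr // (@le_lt_trans _ _ s) ?ge_min ?lexx ?orbT //; lra.
have step (h : C R) : modulus h = k ->
    re (a * h) + re (b * h ^+ 2) + c / 2 * k ^+ 2 <= 0.
  move=> hk; have := rP h; have := sP h; rewrite hk => /(_ ks) h1 /(_ kr).
  by rewrite ler_norml => /andP[h2 _]; lra.
have k2 : 0 < k ^+ 2 by exact: exprn_gt0.
have H1 := step (real_complex R k); have H2 := step (- real_complex R k).
have H3 := step (Complex 0 k); have H4 := step (- Complex 0 k).
rewrite modulusN modulus_real gtr0_norm // in H1 H2.
have mi : modulus (Complex 0 k : C R) = k.
  by rewrite /modulus /= expr0n /= add0r sqrtr_sqr gtr0_norm.
rewrite modulusN mi in H4; rewrite mi in H3.
move: (H1 erefl) (H2 erefl) (H3 erefl) (H4 erefl) c0 k2; clear.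
case: a => a1 a2; case: b => b1 b2 /=; move=> h1 h2 h3 h4 c0 k2.
have : 0 < c * k ^+ 2 by exact: mulr_gt0.
lra.
Qed.

Lemma horner_bounded p (r : R) :
  exists M : R, 0 <= M /\ forall w, modulus w <= r -> modulus p.[w] <= M.
Proof.
elim/poly_ind: p => [|p k [M [M0 IH]]].
  by exists 0; split=> // w _; rewrite horner0 modulus0.
exists (M * `|r| + modulus k); split; first by rewrite addr_ge0 ?mulr_ge0 ?modulus_ge0.
move=> w wr; rewrite !hornerE; apply: le_trans (modulusD _ _) _; rewrite lerD2r modulusM.
by apply: ler_pM; rewrite ?modulus_ge0 ?IH // (le_trans wr) // ler_norm.
Qed.

Lemma poly_expand1 p z : exists q, p = p.[z]%:P + ('X - z%:P) * q.
Proof.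
have /factor_theorem[q qE] : root (p - p.[z]%:P) z by rewrite /root !hornerE subrr.
by exists q; rewrite mulrC -qE addrC subrK.
Qed.

(** Three successive divisions by X - z leave the remainder q3(z + h) h^3, and a polynomial is
    bounded on a disc. *)
Lemma horner_taylor2 p z : exists p2 : C R, exists2 M : R, 0 <= M &
  forall h, modulus h <= 1 ->
  modulus (p.[z + h] - p.[z] - p^`().[z] * h - p2 * h ^+ 2) <= M * modulus h ^+ 3.
Proof.
have [q1 E1] := poly_expand1 p z; have [q2 E2] := poly_expand1 q1 z.
have [q3 E3] := poly_expand1 q2 z.
have [M [M0 MP]] := horner_bounded q3 (modulus z + 1).
exists q2.[z], M => // h h1.
have -> : p^`().[z] = q1.[z].
  have := congr1 (fun r => r^`().[z]) E1.
  rewrite poly.derivD derivC derivM derivB derivX derivC => ->.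
  by rewrite !hornerE subrr mul0r subr0 mul1r !addr0.
have -> : p.[z + h] - p.[z] - q1.[z] * h - q2.[z] * h ^+ 2 = q3.[z + h] * h ^+ 3.
  have H1 := congr1 (horner^~ (z + h)) E1; have H2 := congr1 (horner^~ (z + h)) E2.
  have H3 := congr1 (horner^~ (z + h)) E3.
  rewrite !hornerE in H1 H2 H3.
  rewrite H1 H2 H3; ring.
rewrite modulusM modulusX; apply: ler_wpM2r; first by rewrite exprn_ge0 ?modulus_ge0.
by apply: MP; apply: le_trans (modulusD _ _) _; rewrite lerD2l.
Qed.

(** Expanding |p(z) + p'(z) h + p2 h^2 + ...|^2 up to second order, the only term that is not
    harmonic is |p'(z) h|^2. *)
Lemma expansion2_modulus_sqr p z :
  expansion2 (fun w => modulus p.[w] ^+ 2) z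
    (2 * (conjc p.[z] : C R) * p^`().[z]) (modulus p^`().[z] ^+ 2).
Proof.
have [p2 [M M0 HM]] := horner_taylor2 p z.
set p0 := p.[z]; set p1 := p^`().[z].
exists (2 * (conjc p0 : C R) * p2) => e e0.
pose K := modulus p2 + M.
have K0 : 0 <= K by rewrite addr_ge0 ?modulus_ge0.
pose D := 2 * modulus p0 * M + 2 * modulus p1 * K + K ^+ 2 + 1.
have D0 : 0 < D by rewrite ltr_wpDl // !addr_ge0 // ?exprn_ge0 // !mulr_ge0 // modulus_ge0.
exists (Num.min 1 (e / D)); first by rewrite lt_min ltr01 divr_gt0.
move=> h; rewrite lt_min => /andP[h1 hD].
have := HM h (ltW h1); rewrite -/p0 -/p1; set E := _ - p2 * _ => EM.
set H := modulus h in h1 hD EM *; have H0 : 0 <= H by exact: modulus_ge0.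
pose s := p2 * h ^+ 2 + E.
have sK : modulus s <= K * H ^+ 2.
  apply: le_trans (modulusD _ _) _; rewrite modulusM modulusX -/H /K mulrDl lerD2l.
  apply: le_trans EM _; apply: ler_wpM2l => //.
  by rewrite [H ^+ 3]exprS ler_piMl ?exprn_ge0 // ltW.
have -> : p.[z + h] = p0 + (p1 * h + s) by rewrite /s /E; ring.
set c0 := (conjc p0 : C R).
have re2 (x y : C R) : re (2 * c0 * x * y) = 2 * re (c0 * (x * y)).
  by rewrite -!mulrA; case: (c0 * _) => x' y' /=; ring.
pose A3 := re (c0 * E); pose A6 := re ((conjc (p1 * h) : C R) * s).
have -> : modulus (p0 + (p1 * h + s)) ^+ 2 - modulus p0 ^+ 2 -
    (re (2 * c0 * p1 * h) + re (2 * c0 * p2 * h ^+ 2) + modulus p1 ^+ 2 * H ^+ 2) =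
    2 * A3 + 2 * A6 + modulus s ^+ 2.
  rewrite !re2 modulusD_sqr (modulusD_sqr (p1 * h)) modulusM exprMn -/H -/c0 -/A6.
  have -> : c0 * (p1 * h + s) = c0 * (p1 * h) + (c0 * (p2 * h ^+ 2) + c0 * E).
    by rewrite /s; ring.
  by rewrite !ReD -/A3; ring.
have B1 : `|A3| <= modulus p0 * (M * H ^+ 3).
  apply: le_trans (Re_mul_modulus _ _) _; rewrite modulus_conj.
  by apply: ler_wpM2l => //; exact: modulus_ge0.
have B2 : `|A6| <= modulus p1 * H * (K * H ^+ 2).
  apply: le_trans (Re_mul_modulus _ _) _; rewrite modulus_conj modulusM.
  by apply: ler_wpM2l => //; rewrite mulr_ge0 // modulus_ge0.
have B3 : modulus s ^+ 2 <= K ^+ 2 * H ^+ 3.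
  apply: le_trans (_ : (K * H ^+ 2) ^+ 2 <= _).
    by rewrite lerXn2r ?nnegrE ?modulus_ge0 // mulr_ge0 ?exprn_ge0.
  rewrite exprMn; apply: ler_wpM2l; first exact: exprn_ge0.
  by rewrite -exprM [H ^+ (2 * 2)]exprS ler_piMl ?exprn_ge0 // ltW.
apply: le_trans (ler_normD _ _) _.
apply: le_trans (lerD (ler_normD _ _) (lexx _)) _.
rewrite (@ger0_norm _ (modulus s ^+ 2)) ?exprn_ge0 ?modulus_ge0 //.
have -> : `|2 * A3| = 2 * `|A3| by rewrite normrM ger0_norm.
have -> : `|2 * A6| = 2 * `|A6| by rewrite normrM ger0_norm.
have : D * H * H ^+ 2 <= e * H ^+ 2.
  apply: ler_wpM2r; first exact: exprn_ge0.
  by rewrite mulrC -ler_pdivlMr // ltW.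
have -> : D * H * H ^+ 2 = 2 * (modulus p0 * (M * H ^+ 3)) +
  2 * (modulus p1 * H * (K * H ^+ 2)) + K ^+ 2 * H ^+ 3 + H ^+ 3 by rewrite /D; ring.
have := exprn_ge0 3 H0; lra.
Qed.

End SecondOrder.

(** * Expansions of exponentials and logarithms *)

Section LnExpExpansion.
Variable R : realType.

(** The mean value theorem is applied between 0 and t to f(t0 + x) - f1(t0) x - p2 x^2, whose
    derivative is o(x) by the second hypothesis. *)
Lemma real_taylor2 (f f1 : R -> R) (t0 s p2 : R) : 0 < s ->
  (forall t, `|t| < s -> is_derive (t0 + t) 1 f (f1 (t0 + t))) ->
  (forall e : R, 0 < e -> exists2 r : R, 0 < r & forall t, `|t| < r ->
     `|f1 (t0 + t) - f1 t0 - 2 * p2 * t| <= e * `|t|) ->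
  forall e : R, 0 < e -> exists2 r : R, 0 < r & forall t, `|t| < r ->
    `|f (t0 + t) - f t0 - f1 t0 * t - p2 * t ^+ 2| <= e * t ^+ 2.
Proof.
move=> s0 Hf Hf1 e e0; have [r r0 rP] := Hf1 _ e0.
exists (Num.min s r); first by rewrite lt_min s0.
move=> t; rewrite lt_min => /andP[ts tr].
pose g (x : R) := f (t0 + x) - f1 t0 * x - p2 * (x * x).
pose g1 (x : R) := f1 (t0 + x) - f1 t0 - 2 * p2 * x.
have dg (x : R) : `|x| < s -> is_derive x 1 g (g1 x).
  move=> xs; have Hd := Hf x xs.
  have Hs : is_derive x 1 (cst t0 + id : R -> R) 1.
    by apply: is_derive_eq; rewrite add0r.
  have Hc : is_derive x 1 (f \o (cst t0 + id : R -> R)) (f1 (t0 + x)).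
    by apply: is_derive_eq; rewrite mulr1.
  have Hg : is_derive x 1 ((f \o (cst t0 + id : R -> R)) - (f1 t0) *: (id : R -> R) -
      p2 *: ((id : R -> R) * (id : R -> R))) (g1 x).
    by apply: is_derive_eq; rewrite /g1 /GRing.scale /=; ring.
  exact: Hg.
have key (a b : R) : a < b -> (forall x, x \in `[a, b] -> `|x| <= `|t|) ->
   `|g b - g a| <= e * `|t| * (b - a).
  move=> ab Hab.
  have [|| c cab ->] := @MVT R g g1 a b ab.
  - move=> x xab; apply: dg; apply: le_lt_trans ts; apply: Hab.
    by apply: subset_itv_oo_cc.
  - apply: derivable_within_continuous => x xab.
    by have [] := dg x (le_lt_trans (Hab x xab) ts).
  - have cab' : c \in `[a, b] by apply: subset_itv_oo_cc.
    have ba : 0 <= b - a by rewrite subr_ge0 ltW.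
    rewrite normrM (ger0_norm ba); apply: ler_wpM2r => //.
    have ct := Hab _ cab'; apply: le_trans (rP _ (le_lt_trans ct tr)) _.
    by apply: ler_wpM2l => //; exact: ltW.
have -> : f (t0 + t) - f t0 - f1 t0 * t - p2 * t ^+ 2 = g t - g 0.
  by rewrite /g addr0; ring.
have [t_lt0|t_gt0|->] := ltgtP t 0; last 1 first.
- by rewrite subrr normr0 expr0n mulr0.
- rewrite distrC; apply: le_trans (key t 0 t_lt0 _) _.
    move=> x; rewrite in_itv /= => /andP[x1 x2].
    by rewrite (ler0_norm x2) (ltr0_norm t_lt0) lerN2.
  by rewrite ltr0_norm // le_eqVlt; apply/orP; left; apply/eqP; ring.
- apply: le_trans (key 0 t t_gt0 _) _.
    move=> x; rewrite in_itv /= => /andP[x1 x2].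
    by rewrite (ger0_norm x1) (gtr0_norm t_gt0).
  by rewrite gtr0_norm // le_eqVlt; apply/orP; left; apply/eqP; ring.
Qed.

(** Only 1 + x <= exp x is used: at t it gives the lower bound, and at -t it gives exp t <= 1 / (1 -
    t) <= 1 + t + 2 t^2. *)
Lemma expR_taylor1 (t : R) : `|t| <= 1 / 2 -> `|expR t - 1 - t| <= 2 * t ^+ 2.
Proof.
rewrite ler_norml => /andP[h1 h2].
have g1 := expR_ge1Dx t; have g2 := expR_ge1Dx (- t).
have g0 := expR_gt0 t; have gm : expR t * expR (- t) = 1 by exact: expRxMexpNx_1.
rewrite ger0_norm; last by lra.
have := ler_wpM2l (ltW g0) g2; rewrite gm.
have : (1 + t + 2 * t ^+ 2) * (1 - t) >= 1.
  have -> : (1 + t + 2 * t ^+ 2) * (1 - t) = 1 + t ^+ 2 * (1 - 2 * t) by ring.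
  by rewrite lerDl mulr_ge0 ?sqr_ge0 //; lra.
move=> h3 h4; have : (expR t - (1 + t + 2 * t ^+ 2)) * (1 - t) <= 0 by rewrite mulrBl; lra.
by rewrite pmulr_lle0; lra.
Qed.

Lemma expansion2_expR (u : C R -> R) z a (c : R) : expansion2 u z a c ->
  expansion2 (fun w => expR (u w)) z (real_complex R (expR (u z)) * a)
    (expR (u z) * c + expR (u z) * modulus a ^+ 2 / 4).
Proof.
move=> Hu; have -> : expR (u z) * modulus a ^+ 2 / 4 =
  (expR (u z) / 2) * modulus a ^+ 2 / 2 by field.
apply: expansion2_comp => //; apply: (@real_taylor2 _ (@expR R) (u z) 1) => //.
move=> e e0; pose E := expR (u z); have E0 : 0 < E by exact: expR_gt0.
exists (Num.min (1 / 2) (e / (2 * E))).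
  by rewrite lt_min !divr_gt0 // mulr_gt0.
move=> t; rewrite lt_min => /andP[/ltW t1 te].
have -> : expR (u z + t) - expR (u z) - 2 * (expR (u z) / 2) * t = E * (expR t - 1 - t).
  by rewrite expRD /E; field.
rewrite normrM gtr0_norm //; apply: le_trans (ler_wpM2l (ltW E0) (expR_taylor1 t1)) _.
have tE : `|t| * (2 * E) <= e by rewrite -ler_pdivlMr ?mulr_gt0 // ltW.
rewrite -(real_normK (num_real t)).
have -> : E * (2 * `|t| ^+ 2) = `|t| * (2 * E) * `|t| by ring.
exact: ler_wpM2r.
Qed.

Lemma expansion2_ln (u : C R -> R) z a (c : R) : 0 < u z -> expansion2 u z a c ->
  expansion2 (fun w => ln (u w)) z (real_complex R (u z)^-1 * a)
    (c / u z - modulus a ^+ 2 / (4 * u z ^+ 2)).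
Proof.
move=> u0 Hu; have -> : c / u z - modulus a ^+ 2 / (4 * u z ^+ 2) =
  (u z)^-1 * c + (- (2 * u z ^+ 2)^-1) * modulus a ^+ 2 / 2 by field; lra.
apply: expansion2_comp => //; set y := u z in u0 *.
apply: (@real_taylor2 _ (fun x : R => x^-1) y y) => //.
  move=> t; rewrite ltr_norml => /andP[t1 _]; apply: is_derive1_ln; lra.
move=> e e0; exists (Num.min (y / 2) (e * y ^+ 3 / 2)).
  by rewrite lt_min !divr_gt0 // mulr_gt0 // exprn_gt0.
move=> t; rewrite lt_min => /andP[ty te].
have yt : y / 2 < y + t by move: ty; rewrite ltr_norml => /andP[t1 _]; lra.
have yt0 : 0 < y + t by lra.
have -> : (y + t)^-1 - y^-1 - 2 * - (2 * y ^+ 2)^-1 * t = t ^+ 2 / (y ^+ 2 * (y + t)).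
  by field; rewrite !gt_eqF.
have D0 : 0 < y ^+ 2 * (y + t) by rewrite mulr_gt0 // exprn_gt0.
have te' : `|t| <= e * (y ^+ 2 * (y + t)).
  apply: ltW; apply: lt_le_trans te _.
  have -> : e * y ^+ 3 / 2 = e * (y ^+ 2 * (y / 2)) by field.
  apply: ler_wpM2l; first exact: ltW.
  by apply: ler_wpM2l; [exact: exprn_ge0 (ltW u0)|exact: ltW].
rewrite ger0_norm; last by rewrite divr_ge0 ?sqr_ge0 // ltW.
rewrite ler_pdivrMr // -(real_normK (num_real t)).
have -> : e * `|t| * (y ^+ 2 * (y + t)) = e * (y ^+ 2 * (y + t)) * `|t| by ring.
by rewrite expr2; apply: ler_wpM2r.
Qed.

End LnExpExpansion.

(** * Ahlfors' lemma *)

Section AhlforsLemma.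
Variable R : realType.
Implicit Types (z w h : C R) (p q a b c : {poly C R}).

Local Notation re := (@complex.Re R).

Definition wronskian a b : {poly C R} := a^`() * b - a * b^`().

Lemma expansion2_eq (u : C R -> R) z (k l : C R) (c d : R) :
  expansion2 u z k c -> k = l -> c = d -> expansion2 u z l d.
Proof. by move=> Hu <- <-. Qed.

(** Harmonicity of ln |p|^2 off the zeros of p: the contributions |p'|^2 / |p|^2 and |2 conj(p)
    p'|^2 / (4 |p|^4) to the last coefficient cancel. *)
Lemma expansion2_ln_modulus p z : p.[z] != 0 ->
  expansion2 (fun w => ln (modulus p.[w] ^+ 2)) z (2 * (p^`().[z] / p.[z])) 0.
Proof.
move=> pz; have m0 : 0 < modulus p.[z] by rewrite modulus_gt0.
have m20 : 0 < modulus p.[z] ^+ 2 by rewrite exprn_gt0.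
apply: expansion2_eq (expansion2_ln m20 (expansion2_modulus_sqr p z)) _ _.
  have -> : real_complex R (modulus p.[z] ^+ 2)^-1 = (p.[z] * conjc p.[z] : C R)^-1.
    rewrite -sqr_normc normC_modulus -rmorphXn /= -fmorphV //.
  have cz : (conjc p.[z] : C R) != 0 by rewrite conjc_eq0.
  by field; rewrite pz cz.
have -> : modulus (2 * (conjc p.[z] : C R) * p^`().[z]) ^+ 2 =
   4 * modulus p.[z] ^+ 2 * modulus p^`().[z] ^+ 2.
  rewrite !modulusM !exprMn modulus_conj; congr (_ * _ * _).
  have -> : (2 : C R) = real_complex R 2 by rewrite rmorph_nat.
  by rewrite modulus_real ger0_norm //; ring.
by field; rewrite lt0r_neq0.
Qed.

Definition root2 p z : R := Num.sqrt (modulus p.[z]).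

Lemma root2_gt0 p z : (0 < root2 p z) = (p.[z] != 0).
Proof. by rewrite sqrtr_gt0 modulus_gt0. Qed.

Lemma root2_ge0 p z : 0 <= root2 p z.
Proof. exact: sqrtr_ge0. Qed.

Lemma root2_sqr p z : root2 p z ^+ 2 = modulus p.[z].
Proof. by rewrite sqr_sqrtr ?modulus_ge0. Qed.

(** The form |p|^(1/2) = exp(ln |p|^2 / 4) brings the half powers within reach of the expansions of
    [ln] and [expR]. *)
Lemma root2_expR p z : p.[z] != 0 ->
  expR (1 / 4 * ln (modulus p.[z] ^+ 2)) = root2 p z.
Proof.
move=> pz; have r0 : 0 < root2 p z by rewrite root2_gt0.
rewrite -root2_sqr -exprM lnXn // -[ln _ *+ _]mulr_natl mulrA.
by have -> : 1 / 4 * (2 * 2)%N%:R = 1 :> R; [field|rewrite mul1r lnK].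
Qed.

Lemma ln_root2 p z : p.[z] != 0 -> ln (root2 p z) = 1 / 4 * ln (modulus p.[z] ^+ 2).
Proof. by move=> pz; rewrite -(root2_expR pz) expRK. Qed.

Lemma expansion2_root2 p z : p.[z] != 0 ->
  expansion2 (fun w => expR (1 / 4 * ln (modulus p.[w] ^+ 2))) z
    (real_complex R (root2 p z / 2) * (p^`().[z] / p.[z]))
    (root2 p z * modulus (p^`().[z] / p.[z]) ^+ 2 / 16).
Proof.
move=> pz; have r0 : 0 < root2 p z by rewrite root2_gt0.
have := expansion2_expR (expansion2Z (1 / 4) (expansion2_ln_modulus pz)).
rewrite (root2_expR pz) => H; apply: expansion2_eq H _ _.
  have -> : (2 : C R) = real_complex R 2 by rewrite rmorph_nat.
  by rewrite !mulrA -!rmorphM; congr (real_complex R _ * _ / _); field.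
have -> : (2 : C R) = real_complex R 2 by rewrite rmorph_nat.
rewrite !modulusM !modulus_real !ger0_norm ?divr_ge0 //.
by field.
Qed.

(** Weighted Lagrange identity. It turns the Laplacian of the logarithm of a sum into pairwise
    differences of logarithmic derivatives, each of which is a Wronskian quotient. *)
Lemma lagrange3 (x y t : R) (u v w : C R) :
  (x + y + t) * (x * modulus u ^+ 2 + y * modulus v ^+ 2 + t * modulus w ^+ 2) -
  modulus (real_complex R x * u + real_complex R y * v + real_complex R t * w) ^+ 2 =
  x * y * modulus (u - v) ^+ 2 + x * t * modulus (u - w) ^+ 2 + y * t * modulus (v - w) ^+ 2.
Proof.
by rewrite !modulus_sqr; case: u => a b; case: v => c d; case: w => e f /=; ring.
Qed.

Lemma modulus_logderiv_sub a b z : a.[z] != 0 -> b.[z] != 0 ->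
  modulus (a^`().[z] / a.[z] - b^`().[z] / b.[z]) =
  modulus (wronskian a b).[z] / (root2 a z ^+ 2 * root2 b z ^+ 2).
Proof.
move=> az bz; rewrite !root2_sqr -!modulusM -modulusV -modulusM; congr modulus.
by rewrite /wronskian !hornerE; field; rewrite az bz.
Qed.

Section Triple.
Variables (a b c : {poly C R}) (abc0 : a + b + c = 0).

Lemma wronskian_bc : wronskian b c = wronskian a b.
Proof.
have -> : c = - (a + b) by rewrite -[c](addKr (a + b)) abc0 addr0.
by rewrite /wronskian derivN poly.derivD; ring.
Qed.

Lemma wronskian_ac : wronskian a c = - wronskian a b.
Proof.
have -> : c = - (a + b) by rewrite -[c](addKr (a + b)) abc0 addr0.
by rewrite /wronskian derivN poly.derivD; ring.
Qed.

Definition abc_sum z := root2 a z + root2 b z + root2 c z.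

Definition abc_prod z := root2 a z * root2 b z * root2 c z.

(* The square of the density of the pull-back, under the map a / b, of a
   conformal metric of curvature at most -1/72 on the sphere minus {0, -1, oo}. *)
Definition abc_density z :=
  modulus (wronskian a b).[z] ^+ 2 * abc_sum z / abc_prod z ^+ 3.

Lemma abc_prod_gt0 z : a.[z] != 0 -> b.[z] != 0 -> c.[z] != 0 -> 0 < abc_prod z.
Proof. by move=> az bz cz; rewrite !mulr_gt0 ?root2_gt0. Qed.

Lemma abc_sum_gt0 z : a.[z] != 0 -> 0 < abc_sum z.
Proof.
move=> az; rewrite /abc_sum -addrA ltr_pwDl ?root2_gt0 //.
by rewrite addr_ge0 ?root2_ge0.
Qed.

Lemma abc_density_ge0 z : 0 <= abc_density z.
Proof.
apply: divr_ge0; first apply: mulr_ge0.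
- exact: sqr_ge0.
- by rewrite !addr_ge0 ?root2_ge0.
- by rewrite exprn_ge0 // !mulr_ge0 ?root2_ge0.
Qed.

(** This is the curvature inequality: where W is nonzero, the other factors of the density have
    harmonic logarithms, so [l] is a quarter of the Laplacian of its logarithm. Lagrange's identity
    gives l = |W|^2 (x^3 + y^3 + t^3) / (16 S^2 P^3), with S the sum and P the product of the square
    roots x, y, t; the power mean inequality S^3 <= 9 (x^3 + y^3 + t^3) then yields the constant
    144. *)
Lemma expansion2_ln_sum z : a.[z] != 0 -> b.[z] != 0 -> c.[z] != 0 ->
  exists k l, abc_density z / 144 <= l /\
  expansion2 (fun w => ln (expR (1 / 4 * ln (modulus a.[w] ^+ 2)) +
    expR (1 / 4 * ln (modulus b.[w] ^+ 2)) + expR (1 / 4 * ln (modulus c.[w] ^+ 2)))) z k l.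
Proof.
move=> az bz cz; have S0 := abc_sum_gt0 az; have P0 := abc_prod_gt0 az bz cz.
have := expansion2_ln _ (expansion2D (expansion2D (expansion2_root2 az)
  (expansion2_root2 bz)) (expansion2_root2 cz)).
rewrite /= !root2_expR // -/(abc_sum z) => /(_ S0) H.
eexists; eexists; split; last exact: H.
set x := root2 a z; set y := root2 b z; set t := root2 c z.
have x0 : 0 < x by rewrite root2_gt0. have y0 : 0 < y by rewrite root2_gt0.
have t0 : 0 < t by rewrite root2_gt0.
set al := a^`().[z] / a.[z]; set be := b^`().[z] / b.[z]; set ga := c^`().[z] / c.[z].
have -> : real_complex R (x / 2) * al + real_complex R (y / 2) * be +
    real_complex R (t / 2) * ga = real_complex R (1 / 2) *
   (real_complex R x * al + real_complex R y * be + real_complex R t * ga).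
  have half (k : R) (v : C R) : real_complex R (k / 2) * v =
      real_complex R (1 / 2) * (real_complex R k * v).
    by rewrite [RHS]mulrA -rmorphM; congr (real_complex R _ * _); field.
  by rewrite !mulrDr -!half.
rewrite (modulusM (real_complex R (1 / 2))) modulus_real ger0_norm; last by lra.
have L := lagrange3 x y t al be ga; rewrite -/(abc_sum z) in L.
set M := modulus (_ + _ + _) in L *.
have e1 : modulus (al - be) = modulus (wronskian a b).[z] / (x ^+ 2 * y ^+ 2).
  exact: modulus_logderiv_sub.
have e2 : modulus (al - ga) = modulus (wronskian a b).[z] / (x ^+ 2 * t ^+ 2).
  by rewrite modulus_logderiv_sub // wronskian_ac hornerN modulusN.
have e3 : modulus (be - ga) = modulus (wronskian a b).[z] / (y ^+ 2 * t ^+ 2).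
  by rewrite modulus_logderiv_sub // wronskian_bc.
rewrite e1 e2 e3 in L.
set S := abc_sum z in S0 L *; set W := modulus (wronskian a b).[z] in L *.
set Q := x * modulus al ^+ 2 + y * modulus be ^+ 2 + t * modulus ga ^+ 2 in L.
have -> : (x * modulus al ^+ 2 / 16 + y * modulus be ^+ 2 / 16 + t * modulus ga ^+ 2 / 16)
   / S - (1 / 2 * M) ^+ 2 / (4 * S ^+ 2) = (S * Q - M ^+ 2) / (16 * S ^+ 2).
  by rewrite /Q; field; rewrite lt0r_neq0.
rewrite L {L}.
have -> : abc_density z / 144 = W ^+ 2 * (S ^+ 3 / 9) / (16 * S ^+ 2 * abc_prod z ^+ 3).
  by rewrite /abc_density -/S -/W; field; rewrite !lt0r_neq0.
have -> : (x * y * (W / (x ^+ 2 * y ^+ 2)) ^+ 2 + x * t * (W / (x ^+ 2 * t ^+ 2)) ^+ 2 +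
    y * t * (W / (y ^+ 2 * t ^+ 2)) ^+ 2) / (16 * S ^+ 2) =
  W ^+ 2 * (x ^+ 3 + y ^+ 3 + t ^+ 3) / (16 * S ^+ 2 * abc_prod z ^+ 3).
  by rewrite /abc_prod -/x -/y -/t; field; rewrite !lt0r_neq0.
apply: ler_wpM2r.
  by rewrite invr_ge0 !mulr_ge0 ?exprn_ge0 // ltW.
apply: ler_wpM2l; first exact: sqr_ge0.
rewrite ler_pdivrMr // /S /abc_sum -/x -/y -/t.
have h1 : 0 <= (x + y) * (x - y) ^+ 2 by rewrite mulr_ge0 ?sqr_ge0 //; lra.
have h2 : 0 <= (x + t) * (x - t) ^+ 2 by rewrite mulr_ge0 ?sqr_ge0 //; lra.
have h3 : 0 <= (y + t) * (y - t) ^+ 2 by rewrite mulr_ge0 ?sqr_ge0 //; lra.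
have h4 : 0 <= (x + y + t) * ((x - y) ^+ 2 + (x - t) ^+ 2 + (y - t) ^+ 2).
  by rewrite mulr_ge0 ?addr_ge0 ?sqr_ge0 //; lra.
have -> : (x ^+ 3 + y ^+ 3 + t ^+ 3) * 9 = (x + y + t) ^+ 3 +
  3 * ((x + y) * (x - y) ^+ 2 + (x + t) * (x - t) ^+ 2 + (y + t) * (y - t) ^+ 2) +
  (x + y + t) * ((x - y) ^+ 2 + (x - t) ^+ 2 + (y - t) ^+ 2) by ring.
by lra.
Qed.

End Triple.
End AhlforsLemma.

Lemma modulus_nat (R : realType) n : modulus (n%:R : C R) = n%:R.
Proof.
have -> : (n%:R : C R) = real_complex R n%:R by rewrite rmorph_nat.
by rewrite modulus_real ger0_norm.
Qed.

Lemma cvg_exprn (R : realType) (T : Type) (F : set_system T) (u : T -> R) (l : R) n :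
  Filter F -> u x @[x --> F] --> l -> u x ^+ n @[x --> F] --> l ^+ n.
Proof.
move=> FF ul; elim: n => [|n IH]; first exact: cvg_cst.
have -> : (fun x => u x ^+ n.+1) = (fun x => u x * u x ^+ n).
  by apply/funext => x; rewrite exprS.
by rewrite exprS; exact: cvgM ul IH.
Qed.

(** * The Schwarz-Ahlfors bound on a disc *)

Section AhlforsMax.
Variable R : realType.
Implicit Types (z w h : C R) (p q a b c : {poly C R}).

Lemma continuous_modulus_horner p : continuous (fun w => modulus p.[w]).
Proof.
move=> z; have -> : (fun w => modulus p.[w]) = Num.sqrt \o (fun w => modulus p.[w] ^+ 2).
  by apply/funext => w /=; rewrite sqrtr_sqr ger0_norm ?modulus_ge0.
apply: continuous_comp; last exact: sqrt_continuous.
exact: expansion2_continuous (expansion2_modulus_sqr p z).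
Qed.

Lemma horner_neq0_near p z : p.[z] != 0 ->
  exists2 r : R, 0 < r & forall w, modulus (w - z) < r -> p.[w] != 0.
Proof.
rewrite -modulus_gt0 => pz.
have /continuous_modulusP/(_ _ pz)[r r0 rP] := @continuous_modulus_horner p z.
exists r => // w /rP; rewrite ltr_norml => /andP[h _].
by rewrite -modulus_gt0; lra.
Qed.

Lemma continuous_root2 p : continuous (@root2 R p).
Proof.
move=> z; have -> : root2 p = Num.sqrt \o (fun w => modulus p.[w]) by [].
apply: continuous_comp; last exact: sqrt_continuous.
exact: continuous_modulus_horner.
Qed.

Lemma expansion2_radial (s : R) z :
  expansion2 (fun w => s ^+ 2 - modulus w ^+ 2) z (- 2 * (conjc z : C R)) (- 1).
Proof.
have := expansion2D (expansion2_cst (s ^+ 2) z)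
  (expansion2Z (-1) (expansion2_modulus_sqr 'X z)).
rewrite derivX !hornerE.
have -> : (fun w => s ^+ 2 + -1 * modulus ('X.[w] : C R) ^+ 2) =
          (fun w => s ^+ 2 - modulus w ^+ 2).
  by apply/funext => w; rewrite hornerX mulN1r.
move=> H; apply: expansion2_eq H _ _ => /=.
  by rewrite rmorphN rmorph1 /=; ring.
by rewrite expr1n expr0n addr0 sqrtr1 !mulr1.
Qed.

Section Triple.
Variables (a b c : {poly C R}) (abc0 : a + b + c = 0).

(** Up to the factor 4 s^2, the quotient of sigma^2 by the square of the Poincare density 2 s / (s^2
    - |z|^2) of the disc of radius [s]. *)
Definition ahlfors_ratio (s : R) z := abc_density a b c z * (s ^+ 2 - modulus z ^+ 2) ^+ 2.

Lemma radial_gt0 (s : R) z : modulus z < s -> 0 < s ^+ 2 - modulus z ^+ 2.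
Proof.
by move=> zs; rewrite subr_gt0 ltrXn2r ?nnegrE ?modulus_ge0 // ltW // (le_lt_trans (modulus_ge0 z)).
Qed.

(** The right-hand side has the shape produced by combining the expansion lemmas, so that their sum
    is an expansion of the logarithm of the ratio. *)
Lemma ln_ahlfors_ratio (s : R) z : a.[z] != 0 -> b.[z] != 0 -> c.[z] != 0 ->
  (wronskian a b).[z] != 0 -> modulus z < s ->
  ln (ahlfors_ratio s z) = ln (modulus (wronskian a b).[z] ^+ 2) +
    (ln (expR (1 / 4 * ln (modulus a.[z] ^+ 2)) +
      expR (1 / 4 * ln (modulus b.[z] ^+ 2)) + expR (1 / 4 * ln (modulus c.[z] ^+ 2))) +
    (- (3 / 4) * (ln (modulus a.[z] ^+ 2) + ln (modulus b.[z] ^+ 2) + ln (modulus c.[z] ^+ 2))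
    + 2 * ln (s ^+ 2 - modulus z ^+ 2))).
Proof.
move=> az bz cz Wz zs.
have v0 := radial_gt0 zs; have S0 := abc_sum_gt0 b c az; have P0 := abc_prod_gt0 az bz cz.
have W0 : 0 < modulus (wronskian a b).[z] ^+ 2 by rewrite exprn_gt0 ?modulus_gt0.
have [x0 y0 t0] : [/\ 0 < root2 a z, 0 < root2 b z & 0 < root2 c z].
  by rewrite !root2_gt0.
rewrite !root2_expR // -/(abc_sum a b c z) /ahlfors_ratio /abc_density.
set W := modulus _ ^+ 2 in W0 *; set v := s ^+ 2 - _ in v0 *.
set S := abc_sum a b c z in S0 *; set P := abc_prod a b c z in P0 *.
have -> : ln (W * S / P ^+ 3 * v ^+ 2) = ln W + ln S - 3 * ln P + 2 * ln v.
  have WS : 0 < W * S by exact: mulr_gt0.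
  have P3 : 0 < P ^+ 3 by exact: exprn_gt0.
  have v2 : 0 < v ^+ 2 by exact: exprn_gt0.
  rewrite (@lnM _ (W * S / P ^+ 3)) ?posrE ?divr_gt0 // (@ln_div _ (W * S)) ?posrE //.
  rewrite (@lnM _ W) ?posrE // (lnXn _ P0) (lnXn _ v0).
  by rewrite -[ln P *+ _]mulr_natl -[ln v *+ _]mulr_natl.
have -> : ln P = ln (root2 a z) + ln (root2 b z) + ln (root2 c z).
  by rewrite /P /abc_prod !lnM ?posrE ?mulr_gt0.
by rewrite !ln_root2 //; field.
Qed.

(** At a local maximum the last coefficient of the expansion of the logarithm is at most 0. With v =
    s^2 - |z|^2, the term 2 ln v contributes exactly -2 s^2 / v^2, and the curvature inequality
    leaves density / 144 <= 2 s^2 / v^2. *)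
Lemma ahlfors_ratio_local_max (s : R) z : a.[z] != 0 -> b.[z] != 0 -> c.[z] != 0 ->
  (wronskian a b).[z] != 0 -> modulus z < s ->
  (exists2 r : R, 0 < r & forall w, modulus (w - z) < r ->
     ahlfors_ratio s w <= ahlfors_ratio s z) ->
  ahlfors_ratio s z <= 288 * s ^+ 2.
Proof.
move=> az bz cz Wz zs [r r0 rP]; have v0 := radial_gt0 zs.
have [k [l [lP Hl]]] := expansion2_ln_sum abc0 az bz cz.
have Hv := expansion2Z 2 (expansion2_ln v0 (expansion2_radial s z)).
have Habc := expansion2Z (- (3 / 4)) (expansion2D (expansion2D
  (expansion2_ln_modulus az) (expansion2_ln_modulus bz)) (expansion2_ln_modulus cz)).
have HU := expansion2D (expansion2_ln_modulus Wz) (expansion2D Hl (expansion2D Habc Hv)).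
have [q q0 qP] : exists2 q : R, 0 < q & forall w, modulus (w - z) < q ->
    (a * b * c * wronskian a b).[w] != 0.
  by apply: horner_neq0_near; rewrite !hornerM !mulf_neq0.
have cle := expansion2_max HU; move: cle; rewrite !addr0 mulr0 !add0r => cle.
suff : l + 2 * (- 1 / (s ^+ 2 - modulus z ^+ 2) -
   modulus (- 2 * (conjc z : C R)) ^+ 2 / (4 * (s ^+ 2 - modulus z ^+ 2) ^+ 2)) <= 0.
  have -> : modulus (- 2 * (conjc z : C R)) = 2 * modulus z.
    rewrite modulusM modulus_conj modulusN; congr (_ * _).
    exact: (modulus_nat R 2).
  rewrite /ahlfors_ratio; set v := s ^+ 2 - _ in v0 *.
  have -> : 2 * (-1 / v - (2 * modulus z) ^+ 2 / (4 * v ^+ 2)) = - (2 * s ^+ 2 / v ^+ 2).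
    have -> : s ^+ 2 = v + modulus z ^+ 2 by rewrite /v subrK.
    by field; rewrite lt0r_neq0.
  move=> h; have : abc_density a b c z / 144 <= 2 * s ^+ 2 / v ^+ 2 by lra.
  by rewrite ler_pdivlMr ?exprn_gt0 //; lra.
apply: cle; exists (Num.min q (Num.min r (s - modulus z))).
  by rewrite !lt_min q0 r0 subr_gt0.
move=> h; rewrite !lt_min => /and3P[hq hr hs].
have E : z + h - z = h by rewrite addrC addKr.
have := qP (z + h); rewrite E => /(_ hq); rewrite !hornerM !mulf_eq0 !negb_or.
move=> /andP[/andP[/andP[ah bh] ch] Wh].
have hzs : modulus (z + h) < s by apply: le_lt_trans (modulusD _ _) _; lra.
rewrite -(ln_ahlfors_ratio ah bh ch Wh hzs) -(ln_ahlfors_ratio az bz cz Wz zs).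
have pos w : a.[w] != 0 -> b.[w] != 0 -> c.[w] != 0 ->
  (wronskian a b).[w] != 0 -> modulus w < s -> ahlfors_ratio s w \in Num.pos.
  move=> aw bw cw Ww ws; rewrite posrE mulr_gt0 ?exprn_gt0 ?radial_gt0 //.
  by rewrite divr_gt0 ?exprn_gt0 ?abc_prod_gt0 // mulr_gt0 ?exprn_gt0 ?modulus_gt0 ?abc_sum_gt0.
by rewrite ler_ln ?pos //; apply: rP; rewrite E.
Qed.

Lemma continuous_abc_density z : a.[z] != 0 -> b.[z] != 0 -> c.[z] != 0 ->
  {for z, continuous (abc_density a b c)}.
Proof.
move=> az bz cz; have cr (p : {poly C R}) : root2 p x @[x --> z] --> root2 p z.
  exact: continuous_root2.
have HW : modulus (wronskian a b).[x] ^+ 2 @[x --> z] --> modulus (wronskian a b).[z] ^+ 2.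
  exact: expansion2_continuous (expansion2_modulus_sqr _ z).
have HS : abc_sum a b c x @[x --> z] --> abc_sum a b c z.
  exact: cvgD (cvgD (cr a) (cr b)) (cr c).
have HP : abc_prod a b c x @[x --> z] --> abc_prod a b c z.
  exact: cvgM (cvgM (cr a) (cr b)) (cr c).
have HP3 : abc_prod a b c x ^+ 3 @[x --> z] --> abc_prod a b c z ^+ 3.
  apply: cvg_exprn HP.
apply: (cvgM (cvgM HW HS)); apply: cvgV HP3.
by rewrite lt0r_neq0 ?exprn_gt0 ?abc_prod_gt0.
Qed.

(** The ratio vanishes on the boundary circle and tends to 0 at the origin, so its maximum over the
    closed disc is either 0 or attained where [ahlfors_ratio_local_max] applies. *)
Lemma ahlfors_bound (s : R) : 0 < s ->
  (forall z, z != 0 -> modulus z <= s -> [/\ a.[z] != 0, b.[z] != 0 & c.[z] != 0]) ->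
  (forall e : R, 0 < e -> exists2 r : R, 0 < r &
     forall z, z != 0 -> modulus z < r -> abc_density a b c z < e) ->
  forall z, z != 0 -> modulus z <= s -> ahlfors_ratio s z <= 288 * s ^+ 2.
Proof.
move=> s0 Habc H0 z0 z00 z0s.
(* The origin, where [a], [b] or [c] may vanish, receives the value 0; the vanishing hypothesis on
   the density makes [f] continuous there. *)
pose f z := if z == 0 then 0 else ahlfors_ratio s z.
have f_ge0 z : 0 <= f z.
  by rewrite /f; case: eqP => // _; rewrite mulr_ge0 ?abc_density_ge0 ?sqr_ge0.
have cv z : {for z, continuous (fun w => (s ^+ 2 - modulus w ^+ 2) ^+ 2)}.
  by have H := expansion2_continuous (expansion2_radial s z); apply: cvg_exprn H.
have fc z : cdisc 0 s z -> {for z, continuous f}.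
  rewrite /cdisc /= subr0 => zs; have [->|zn0] := eqVneq z 0.
    apply/continuous_modulusP => e e0.
    have e1 : 0 < e / s ^+ 4 by rewrite divr_gt0 ?exprn_gt0.
    have [r r0 rP] := H0 _ e1.
    exists (Num.min r s); first by rewrite lt_min r0.
    move=> w; rewrite subr0 lt_min => /andP[wr ws].
    rewrite {2}/f eqxx subr0 ger0_norm // /f; case: eqVneq => // wn0.
    have v1 := radial_gt0 ws.
    have v2 : (s ^+ 2 - modulus w ^+ 2) ^+ 2 <= s ^+ 4.
      have v3 : s ^+ 2 - modulus w ^+ 2 <= s ^+ 2 by rewrite lerBlDr lerDl sqr_ge0.
      by rewrite (exprM s 2 2) lerXn2r ?nnegrE ?sqr_ge0 // (ltW v1).
    have := rP w wn0 wr; rewrite ltr_pdivlMr ?exprn_gt0 //.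
    by apply: le_lt_trans; apply: ler_wpM2l => //; exact: abc_density_ge0.
  have [az bz cz] := Habc z zn0 zs.
  have H : {for z, continuous (ahlfors_ratio s)}.
    exact: cvgM (continuous_abc_density az bz cz) (cv z).
  move: H => /continuous_modulusP H; apply/continuous_modulusP => e e0.
  have [r r0 rP] := H _ e0; exists (Num.min r (modulus z)).
    by rewrite lt_min r0 modulus_gt0.
  move=> w; rewrite lt_min => /andP[wr wz]; rewrite /f (negbTE zn0).
  case: eqVneq => w0; last exact: rP.
  by move: wz; rewrite w0 sub0r modulusN ltxx.
have [zm] : exists2 c0, c0 \in cdisc (0 : C R) s & forall t, t \in cdisc 0 s -> f t <= f c0.
  apply: compact_EVT_max.
  - by exists 0; rewrite /cdisc /mkset subrr modulus0 ltW.
  - exact: compact_cdisc.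
  - by apply: continuous_in_subspaceT => z; rewrite inE => /fc.
rewrite inE => zms zmax.
have zmle : f zm <= 288 * s ^+ 2.
  (* A nonzero maximum rules out the origin, the boundary circle and the zeros of the Wronskian at
     once. *)
  have [->|fn0] := eqVneq (f zm) 0; first by rewrite mulr_ge0 ?ler0n ?sqr_ge0.
  have zmn0 : zm != 0 by apply: contra_neq fn0 => ->; rewrite /f eqxx.
  move: zms fn0; rewrite /cdisc /= subr0 /f (negbTE zmn0) => zms fn0.
  have [az bz cz] := Habc zm zmn0 zms.
  have zmlt : modulus zm < s.
    rewrite lt_neqAle zms andbT; apply: contra_neq fn0 => E.
    by rewrite /ahlfors_ratio E subrr expr0n mulr0.
  have Wz : (wronskian a b).[zm] != 0.
    apply: contra_neq fn0 => W0.
    by rewrite /ahlfors_ratio /abc_density W0 modulus0 expr0n !mul0r.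
  apply: ahlfors_ratio_local_max => //.
  exists (Num.min (s - modulus zm) (modulus zm)); first by rewrite lt_min subr_gt0 zmlt modulus_gt0.
  move=> w; rewrite lt_min => /andP[w1 w2].
  have ws : modulus w <= s.
    by rewrite -[w](subrK zm); apply: le_trans (modulusD _ _) _; lra.
  have wn0 : w != 0.
    by apply/eqP => w0; move: w2; rewrite w0 sub0r modulusN ltxx.
  have := zmax w; rewrite inE /cdisc /= subr0 => /(_ ws).
  by rewrite /f (negbTE zmn0) (negbTE wn0).
apply: le_trans zmle; have := zmax z0; rewrite inE /cdisc /= subr0 => /(_ z0s).
by rewrite /f (negbTE z00).
Qed.

(** The left-hand side is the square of the spherical derivative of a / b, up to a constant factor.
    With x, y, t the square roots of |a|, |b|, |c|, S their sum, P their product and N = x^4 + y^4,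
    the claim is P^3 <= 128^2 S N^2. It follows from 27 P <= S^3 and from S^4 <= 128 N, the latter
    because t <= x + y. *)
Lemma spherical_derivative_le z : a.[z] != 0 -> b.[z] != 0 -> c.[z] != 0 ->
  (modulus (wronskian a b).[z] / (modulus a.[z] ^+ 2 + modulus b.[z] ^+ 2)) ^+ 2
    <= 128 ^+ 2 * abc_density a b c z.
Proof.
move=> az bz cz; rewrite /abc_density exprMn.
set W2 := modulus (wronskian a b).[z] ^+ 2.
have -> : 128 ^+ 2 * (W2 * abc_sum a b c z / abc_prod a b c z ^+ 3) =
  W2 * (128 ^+ 2 * abc_sum a b c z / abc_prod a b c z ^+ 3).
  by move: (128 ^+ 2 : R) (abc_sum a b c z) (abc_prod a b c z ^+ 3)^-1 W2 => *; ring.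
apply: ler_wpM2l; first exact: sqr_ge0.
have P0 := abc_prod_gt0 az bz cz; have S0 := abc_sum_gt0 b c az.
have cab : modulus c.[z] <= modulus a.[z] + modulus b.[z].
  have -> : c = - (a + b) by rewrite -[c](addKr (a + b)) abc0 addr0.
  by rewrite hornerN modulusN hornerD modulusD.
rewrite -!root2_sqr in cab *; rewrite /abc_sum /abc_prod in P0 S0 *.
have x0 : 0 < root2 a z by rewrite root2_gt0.
have y0 : 0 < root2 b z by rewrite root2_gt0.
have t0 : 0 < root2 c z by rewrite root2_gt0.
move: x0 y0 t0 P0 S0 cab.
set x := root2 a z; set y := root2 b z; set t := root2 c z => x0 y0 t0 P0 S0 cab.
have txy : t <= x + y.
  rewrite -(@ler_pXn2r _ 2) ?nnegrE //; try by lra.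
  by apply: le_trans cab _; rewrite sqrrD; have := mulr_gt0 x0 y0; lra.
set N := (x ^+ 2) ^+ 2 + (y ^+ 2) ^+ 2.
have N0 : 0 < N by rewrite addr_gt0 // !exprn_gt0.
have amgm : 27 * (x * y * t) <= (x + y + t) ^+ 3.
  have h1 : 0 <= t * (x - y) ^+ 2 by rewrite mulr_ge0 ?sqr_ge0 //; lra.
  have h2 : 0 <= y * (x - t) ^+ 2 by rewrite mulr_ge0 ?sqr_ge0 //; lra.
  have h3 : 0 <= x * (y - t) ^+ 2 by rewrite mulr_ge0 ?sqr_ge0 //; lra.
  have h4 : 0 <= (x + y + t) * ((x - y) ^+ 2 + (x - t) ^+ 2 + (y - t) ^+ 2).
    by rewrite mulr_ge0 ?addr_ge0 ?sqr_ge0 //; lra.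
  have -> : (x + y + t) ^+ 3 = 27 * (x * y * t) +
   ((x + y + t) * ((x - y) ^+ 2 + (x - t) ^+ 2 + (y - t) ^+ 2)) / 2 +
   3 * (t * (x - y) ^+ 2 + y * (x - t) ^+ 2 + x * (y - t) ^+ 2) by field.
  by lra.
have S4 : (x + y + t) ^+ 4 <= 128 * N.
  apply: (@le_trans _ _ ((2 * (x + y)) ^+ 4)).
    by apply: lerXn2r; rewrite ?nnegrE; lra.
  have -> : 128 * N = (2 * (x + y)) ^+ 4 +
     16 * (x - y) ^+ 2 * (7 * x ^+ 2 + 10 * (x * y) + 7 * y ^+ 2) by rewrite /N; ring.
  rewrite lerDl; apply: mulr_ge0; first by rewrite mulr_ge0 ?ler0n ?sqr_ge0.
  by have := mulr_gt0 x0 y0; have := sqr_ge0 x; have := sqr_ge0 y; lra.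
set S := x + y + t in S0 amgm S4 *; set P := x * y * t in P0 amgm *.
rewrite exprVn ler_pdivlMr ?exprn_gt0 // mulrC ler_pdivrMr ?exprn_gt0 //.
have A1 : (27 * P) ^+ 3 <= (S ^+ 3) ^+ 3.
  by apply: lerXn2r; rewrite ?nnegrE ?exprn_ge0 ?(ltW S0) //; lra.
have A2 : (S ^+ 4) ^+ 2 <= (128 * N) ^+ 2.
  by apply: lerXn2r; rewrite ?nnegrE ?exprn_ge0 ?(ltW S0) //; lra.
have A3 : S * (S ^+ 4) ^+ 2 <= S * (128 * N) ^+ 2 by apply: ler_wpM2l A2; exact: ltW.
have A4 : P ^+ 3 <= (27 * P) ^+ 3 by apply: lerXn2r; rewrite ?nnegrE; lra.
apply: le_trans A4 (le_trans A1 _).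
have -> : (S ^+ 3) ^+ 3 = S * (S ^+ 4) ^+ 2 by rewrite -!exprM -exprS.
by apply: le_trans A3 _; rewrite exprMn mulrA [S * _]mulrC.
Qed.

End Triple.
End AhlforsMax.

(** * Chordal distance and equicontinuity *)

Section Chordal.
Variable R : realType.
Implicit Types (p q r : C R * C R) (z w : C R) (s t : sphere R).

Definition pnorm p : R := Num.sqrt (modulus p.1 ^+ 2 + modulus p.2 ^+ 2).

Definition wedge p q : C R := p.1 * q.2 - p.2 * q.1.

(* The chordal distance of the points with homogeneous coordinates p and q. *)
Definition chord p q : R := modulus (wedge p q) / (pnorm p * pnorm q).

Definition nonzero p := (p.1 != 0) || (p.2 != 0).

Lemma pnorm_ge0 p : 0 <= pnorm p.
Proof. exact: sqrtr_ge0. Qed.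

Lemma pnorm_sqr p : pnorm p ^+ 2 = modulus p.1 ^+ 2 + modulus p.2 ^+ 2.
Proof. by rewrite sqr_sqrtr // addr_ge0 ?sqr_ge0. Qed.

Lemma pnorm_gt0 p : nonzero p -> 0 < pnorm p.
Proof.
rewrite sqrtr_gt0 => /orP[|]; rewrite -modulus_gt0 => h.
  by rewrite ltr_pwDl ?sqr_ge0 ?exprn_gt0.
by rewrite ltr_wpDl ?sqr_ge0 ?exprn_gt0.
Qed.

Lemma cauchy_pnorm p z w : modulus (p.1 * z + p.2 * w) <= pnorm p * pnorm (z, w).
Proof.
rewrite -(@ler_pXn2r _ 2) ?nnegrE ?modulus_ge0 ?mulr_ge0 ?pnorm_ge0 //.
rewrite exprMn !pnorm_sqr /=.
apply: (@le_trans _ _ ((modulus p.1 * modulus z + modulus p.2 * modulus w) ^+ 2)).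
  apply: lerXn2r; rewrite ?nnegrE ?modulus_ge0 ?addr_ge0 ?mulr_ge0 ?modulus_ge0 //.
  by rewrite -!modulusM modulusD.
rewrite -subr_ge0.
have -> : (modulus p.1 ^+ 2 + modulus p.2 ^+ 2) * (modulus z ^+ 2 + modulus w ^+ 2) -
  (modulus p.1 * modulus z + modulus p.2 * modulus w) ^+ 2 =
  (modulus p.1 * modulus w - modulus p.2 * modulus z) ^+ 2 by ring.
exact: sqr_ge0.
Qed.

Lemma chord_ge0 p q : 0 <= chord p q.
Proof. by rewrite divr_ge0 ?modulus_ge0 ?mulr_ge0 ?pnorm_ge0. Qed.

Lemma chordC p q : chord p q = chord q p.
Proof.
rewrite /chord [pnorm q * _]mulrC; congr (_ / _).
by rewrite /wedge -modulusN; congr modulus; ring.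
Qed.

Lemma chordxx p : chord p p = 0.
Proof. by rewrite /chord /wedge [p.1 * _]mulrC subrr modulus0 mul0r. Qed.

Lemma modulus_wedge p q : nonzero p -> nonzero q ->
  modulus (wedge p q) = chord p q * (pnorm p * pnorm q).
Proof. by move=> p0 q0; rewrite divfK // mulf_neq0 ?lt0r_neq0 ?pnorm_gt0. Qed.

Lemma chord_eq0 p q : nonzero p -> nonzero q -> (chord p q == 0) = (wedge p q == 0).
Proof.
move=> p0 q0; have N0 : 0 < pnorm p * pnorm q by rewrite mulr_gt0 ?pnorm_gt0.
by rewrite /chord mulf_eq0 invr_eq0 (gt_eqF N0) orbF modulus_eq0.
Qed.

(** With q' the conjugate of q and <u, v> = u.1 v.1 + u.2 v.2, the identity (p ^ r) <q, q'> = (p ^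
    q) <r, q'> + (q ^ r) <p, q'> between wedges reduces the claim to Cauchy-Schwarz. *)
Lemma chord_triangle p q r : nonzero p -> nonzero q -> nonzero r ->
  chord p r <= chord p q + chord q r.
Proof.
move=> p0 q0 r0; have P := pnorm_gt0 p0; have Q := pnorm_gt0 q0; have S := pnorm_gt0 r0.
rewrite ler_pdivrMr ?mulr_gt0 // -(ler_pM2r (exprn_gt0 2 Q)).
pose q' : C R * C R := (conjc q.1, conjc q.2).
have nq : pnorm q' = pnorm q by rewrite /pnorm /= !modulus_conj.
have -> : modulus (wedge p r) * pnorm q ^+ 2 = modulus (wedge p r * (q.1 * q'.1 + q.2 * q'.2)).
  rewrite modulusM; congr (_ * _).
  have -> : q.1 * q'.1 + q.2 * q'.2 = real_complex R (pnorm q ^+ 2).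
    by rewrite pnorm_sqr rmorphD /= !rmorphXn /= -!normC_modulus !sqr_normc.
  by rewrite modulus_real ger0_norm // sqr_ge0.
have -> : wedge p r * (q.1 * q'.1 + q.2 * q'.2) =
  wedge p q * (r.1 * q'.1 + r.2 * q'.2) + wedge q r * (p.1 * q'.1 + p.2 * q'.2).
  by rewrite /wedge; ring.
apply: le_trans (modulusD _ _) _; rewrite !modulusM !modulus_wedge //.
apply: (@le_trans _ _ (chord p q * (pnorm p * pnorm q) * (pnorm r * pnorm q) +
   chord q r * (pnorm q * pnorm r) * (pnorm p * pnorm q))).
  have cq v : modulus (v.1 * q'.1 + v.2 * q'.2) <= pnorm v * pnorm q.
    by rewrite -nq; exact: cauchy_pnorm.
  apply: lerD; apply: ler_wpM2l (cq _); apply: mulr_ge0; rewrite ?chord_ge0 //.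
    by rewrite mulr_ge0 ?pnorm_ge0.
  by rewrite mulr_ge0 ?pnorm_ge0.
by rewrite le_eqVlt; apply/orP; left; apply/eqP; ring.
Qed.

Lemma chord_le1 p q : nonzero p -> nonzero q -> chord p q <= 1.
Proof.
move=> p0 q0; rewrite ler_pdivrMr ?mulr_gt0 ?pnorm_gt0 // mul1r /wedge -mulrN.
apply: le_trans (cauchy_pnorm p q.2 (- q.1)) _.
apply: ler_wpM2l; first exact: pnorm_ge0.
by rewrite /pnorm /= modulusN addrC.
Qed.

Lemma chordZl (k : C R) p q : k != 0 -> chord (k * p.1, k * p.2) q = chord p q.
Proof.
move=> k0; have m0 : 0 < modulus k by rewrite modulus_gt0.
have -> : chord (k * p.1, k * p.2) q =
   (modulus k * modulus (wedge p q)) / ((modulus k * pnorm p) * pnorm q).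
  rewrite /chord; congr (_ / (_ * _)).
    by rewrite -modulusM; congr modulus; rewrite /wedge /=; ring.
  rewrite /pnorm /= !modulusM !exprMn -mulrDr sqrtrM ?sqr_ge0 // sqrtr_sqr.
  by rewrite ger0_norm // ltW.
by rewrite -[modulus k * pnorm p * _]mulrA -mulf_div divff ?mul1r // lt0r_neq0.
Qed.

Definition coords s : C R * C R := if s is Some z then (z, 1) else (1, 0).

Lemma coords_nonzero s : nonzero (coords s).
Proof. by case: s => [z|]; rewrite /nonzero /= oner_eq0 ?orbT. Qed.

(** Homogeneous coordinates, with infinity as (1 : 0), absorb the case distinction in
    [half_chord]. *)
Lemma half_chordE s t : half_chord s t = chord (coords s) (coords t).
Proof.
have n1 z : pnorm (z, 1) = Num.sqrt (1 + modulus z ^+ 2).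
  by rewrite /pnorm modulus1 expr1n addrC.
have n0 : pnorm (1, 0) = 1 by rewrite /pnorm modulus1 modulus0 expr1n expr0n addr0 sqrtr1.
case: s t => [z|] [w|]; rewrite /chord /coords ?n1 ?n0 /half_chord.
- by have -> : wedge (z, 1) (w, 1) = z - w by rewrite /wedge /=; ring.
- have -> : wedge (z, 1) (1, 0) = -1 by rewrite /wedge /=; ring.
  by rewrite modulusN modulus1 mulr1 div1r.
- have -> : wedge (1, 0) (w, 1) = 1 by rewrite /wedge /=; ring.
  by rewrite modulus1 !mul1r.
- have -> : wedge (1, 0) (1, 0) = 0 by rewrite /wedge /=; ring.
  by rewrite modulus0 mul0r.
Qed.

Section Rational.
Variables (a b : {poly C R}) (ab : coprimep a b).

Definition pvalue z : C R * C R := (a.[z], b.[z]).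

Lemma pvalue_nonzero z : nonzero (pvalue z).
Proof.
rewrite /nonzero /=; have [a0|//] := eqVneq a.[z] 0.
have := @coprimep_root _ a b z ab; rewrite /root a0 eqxx => /(_ isT) ->.
by rewrite orbT.
Qed.

(** For coprime polynomials the gcd is a nonzero constant, and cancelling it only rescales the
    homogeneous coordinates. *)
Lemma coords_rational_map z : exists2 k : C R, k != 0 &
  pvalue z = (k * (coords (rational_map a b z)).1, k * (coords (rational_map a b z)).2).
Proof.
have /size_poly1P[g g0 gE] : size (gcdp a b) == 1%N by [].
have aE : a %/ gcdp a b = g^-1 *: a by rewrite gE -alg_polyC divpZr // divp1.
have bE : b %/ gcdp a b = g^-1 *: b by rewrite gE -alg_polyC divpZr // divp1.
have nz := pvalue_nonzero z; rewrite /rational_map aE bE !hornerZ mulf_eq0 invr_eq0.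
rewrite (negbTE g0) /=; rewrite /nonzero /pvalue /= in nz *.
have [b0|b0] := eqVneq b.[z] 0.
  move: nz; rewrite b0 eqxx orbF => a0; exists a.[z] => //=.
  by rewrite mulr0 mulr1.
exists b.[z] => //=; rewrite mulr1; congr (_, _).
by rewrite invfM invrK; field; rewrite b0 g0.
Qed.

Lemma chord_rational_map z p :
  chord (coords (rational_map a b z)) p = chord (pvalue z) p.
Proof. by have [k k0 ->] := coords_rational_map z; rewrite chordZl. Qed.

End Rational.

(** Together with [half_chord_lt] this is the uniform equivalence of the great-circle and chordal
    distances. The cap pi / 2 in [m] keeps to the range where the sine increases. *)
Lemma spherical_dist_lt (e : R) : 0 < e -> exists2 r : R, 0 < r &
  forall s t, half_chord s t < r -> spherical_dist s t < e.
Proof.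
move=> e0; pose m := Num.min (e / 2) (pi / 2) : R.
have pi0 := pi_gt0 R.
have m0 : 0 < m by rewrite lt_min !divr_gt0.
have mpi : m <= pi / 2 by rewrite ge_min lexx orbT.
have me : m <= e / 2 by rewrite ge_min lexx.
exists (sin m); first by apply: sin_gt0_pi; apply/andP; split; lra.
move=> s t; rewrite /spherical_dist half_chordE => h.
have c0 := chord_ge0 (coords s) (coords t).
have c1 := chord_le1 (coords_nonzero s) (coords_nonzero t).
set x := chord _ _ in h c0 c1 *.
have x1 : -1 <= x <= 1 by apply/andP; split; lra.
suff : asin x < m by lra.
rewrite -ltr_sin ?asinK ?in_itv //=; first by rewrite asin_geNpi2 ?asin_lepi2.
by apply/andP; split; lra.
Qed.

Lemma half_chord_lt (r : R) : 0 < r -> exists2 e : R, 0 < e &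
  forall s t, spherical_dist s t < e -> half_chord s t < r.
Proof.
move=> r0; have := @continuous_sin R 0; rewrite /continuous_at sin0.
move=> /cvgrPdist_lt /(_ _ r0) /nbhs_ballP[e /= e0 eP].
exists e => // s t; rewrite /spherical_dist half_chordE.
have c0 := chord_ge0 (coords s) (coords t).
have c1 := chord_le1 (coords_nonzero s) (coords_nonzero t).
set x := chord _ _ in c0 c1 * => h.
have x1 : -1 <= x <= 1 by apply/andP; split; lra.
have sx : sin (asin x) = x by rewrite asinK // in_itv.
have y0 : 0 <= asin x.
  rewrite leNgt; apply/negP => y0.
  have : 0 < sin (- asin x).
    apply: sin_gt0_pi; apply/andP; split; first by lra.
    by have := asin_geNpi2 x1; have := pi_gt0 R; lra.
  by rewrite sinN sx; lra.
have := eP (asin x); rewrite /ball /= !sub0r !normrN sx !ger0_norm //.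
by apply; lra.
Qed.

End Chordal.

(** * From the spherical derivative to a Lipschitz bound *)

Section Equicontinuity.
Variable R : realType.
Implicit Types (z w : C R) (a b c p q : {poly C R}).

(** The supremum s of the t in [0, 1] with D 0 t <= K t satisfies this bound itself, and the local
    estimate at s would carry the bound beyond s if s were less than 1. *)
Lemma segment_lipschitz (D : R -> R -> R) (K : R) : 0 <= K ->
  (forall s t, D s t = D t s) -> (forall s t u, D s u <= D s t + D t u) ->
  (forall t, 0 <= t <= 1 -> exists2 r : R, 0 < r &
    forall u, 0 <= u <= 1 -> `|u - t| < r -> D t u <= K * `|u - t|) ->
  D 0 1 <= K.
Proof.
move=> K0 Dsym Dtri Dloc.
pose E := [set t | 0 <= t <= 1 /\ D 0 t <= K * t].
have E0 : E 0.
  split; first by rewrite lexx ler01.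
  have [|r r0 /(_ 0)] := Dloc 0; first by rewrite lexx ler01.
  by rewrite lexx ler01 subrr normr0 => /(_ isT r0).
have supE : has_sup E.
  by split; [exists 0|exists 1 => t [/andP[]]].
set s := sup E.
have s0 : 0 <= s by apply: ub_le_sup; [case: supE|].
have s1 : s <= 1 by apply: ge_sup; [exists 0|move=> t [/andP[]]].
have s01 : 0 <= s <= 1 by rewrite s0.
have [r r0 rP] := Dloc s s01.
have Es : D 0 s <= K * s.
  have [t Et ts] := sup_adherent r0 supE.
  have tle : t <= s by apply: ub_le_sup => //; case: supE.
  case: Et => t01 Dt; rewrite -/s in ts.
  have := rP t t01; rewrite distrC ger0_norm ?subr_ge0 // => /(_ _) Dst.
  have {}Dst : D s t <= K * (s - t) by apply: Dst; lra.
  by apply: le_trans (Dtri 0 t s) _; rewrite (Dsym t s); lra.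
have [s_lt1|s_ge1] := ltP s 1; last first.
  have -> : 1 = s by lra.
  by apply: le_trans Es _; rewrite ler_piMr.
pose u := Num.min 1 (s + r / 2).
have su : s < u by rewrite lt_min s_lt1 /=; lra.
have u1 : u <= 1 by rewrite ge_min lexx.
have ur : u <= s + r / 2 by rewrite ge_min lexx orbT.
have Eu : E u.
  split; first by apply/andP; split; lra.
  have us : 0 <= u - s by lra.
  have := rP u; rewrite (ger0_norm us) => H.
  have {}H : D s u <= K * (u - s) by apply: H; [apply/andP; split|]; lra.
  by apply: le_trans (Dtri 0 s u) _; lra.
have : u <= s by apply: ub_le_sup => //; case: supE.
by rewrite leNgt su.
Qed.

(** The wedge of the values at z and w is q(w) with q = a(z) b - b(z) a, which vanishes at z with
    derivative -W(z). The margin [e] absorbs the second-order terms and the variation of [pnorm]. *)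
Lemma chord_local_lipschitz a b z (L e : R) : nonzero (pvalue a b z) -> 0 < e -> 0 <= L ->
  modulus (wronskian a b).[z] <= L * (modulus a.[z] ^+ 2 + modulus b.[z] ^+ 2) ->
  exists2 r : R, 0 < r & forall w, modulus (w - z) < r ->
    chord (pvalue a b z) (pvalue a b w) <= (L + e) * modulus (w - z).
Proof.
move=> nz e0 L0 WL; set N := pnorm (pvalue a b z).
have N0 : 0 < N by exact: pnorm_gt0.
have {}WL : modulus (wronskian a b).[z] <= L * N ^+ 2 by rewrite pnorm_sqr.
pose q := a.[z] *: b - b.[z] *: a.
have [p2 [M M0 HM]] := horner_taylor2 q z.
have q0 : q.[z] = 0 by rewrite /q !hornerE mulrC subrr.
have q1 : q^`().[z] = - (wronskian a b).[z].
  by rewrite /q /wronskian derivB !derivZ !hornerE; ring.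
pose K := modulus p2 + M; have K0 : 0 <= K by rewrite addr_ge0 ?modulus_ge0.
have cN : {for z, continuous (fun w => pnorm (pvalue a b w))}.
  have H : modulus a.[x] ^+ 2 + modulus b.[x] ^+ 2 @[x --> z] --> modulus a.[z] ^+ 2 + modulus b.[z] ^+ 2.
    exact: cvgD (expansion2_continuous (expansion2_modulus_sqr a z))
      (expansion2_continuous (expansion2_modulus_sqr b z)).
  have -> : (fun w => pnorm (pvalue a b w)) =
    Num.sqrt \o (fun w => modulus a.[w] ^+ 2 + modulus b.[w] ^+ 2) by [].
  by apply: continuous_comp; [exact: H|exact: sqrt_continuous].
pose eta := e * N / (2 * (L + e)).
have Le : 0 < L + e by lra.
have eta0 : 0 < eta by rewrite divr_gt0 // mulr_gt0.
have /continuous_modulusP/(_ _ eta0)[r r0 rP] := cN.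
pose k := e * N ^+ 2 / (2 * (K + 1)).
have k0 : 0 < k by rewrite divr_gt0 ?mulr_gt0 ?exprn_gt0 //; lra.
exists (Num.min (Num.min r 1) k); first by rewrite !lt_min r0 ltr01.
move=> w; rewrite !lt_min -andbA => /and3P[wr w1 wk].
have := rP _ wr; rewrite -/N; set N' := pnorm (pvalue a b w); rewrite ltr_norml => /andP[Nlo _].
set H := modulus (w - z) in wr w1 wk *; have H0 : 0 <= H by exact: modulus_ge0.
have N'0 : 0 <= N' by exact: pnorm_ge0.
have wz : wedge (pvalue a b z) (pvalue a b w) = q.[z + (w - z)].
  by rewrite [z + _]addrC subrK /q /wedge /= !hornerE.
have Wle : modulus (wedge (pvalue a b z) (pvalue a b w)) <= (L * N ^+ 2 + K * H) * H.
  rewrite wz; have := HM (w - z) (ltW w1); rewrite q0 q1 subr0; set T := q.[_] => HT.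
  have -> : T = (T - - (wronskian a b).[z] * (w - z) - p2 * (w - z) ^+ 2) +
     (- (wronskian a b).[z] * (w - z) + p2 * (w - z) ^+ 2) by ring.
  apply: le_trans (modulusD _ _) _.
  have T2 := modulusD (- (wronskian a b).[z] * (w - z)) (p2 * (w - z) ^+ 2).
  rewrite (modulusM p2) (modulusM (- _)) modulusN modulusX -/H in T2; rewrite -/H in HT.
  have H3 : M * H ^+ 3 <= M * H ^+ 2.
    by apply: ler_wpM2l => //; rewrite exprS ler_piMl ?exprn_ge0 // ltW.
  have H1 : modulus (wronskian a b).[z] * H <= L * N ^+ 2 * H by apply: ler_wpM2r.
  have -> : (L * N ^+ 2 + K * H) * H = L * N ^+ 2 * H + modulus p2 * H ^+ 2 + M * H ^+ 2.
    by rewrite /K; ring.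
  by lra.
rewrite /chord -/N -/N'; have [N'e|N'n0] := eqVneq N' 0.
  by rewrite N'e mulr0 invr0 mulr0 mulr_ge0 // ltW.
have N'p : 0 < N' by rewrite lt_def N'n0.
rewrite ler_pdivrMr ?mulr_gt0 //; apply: le_trans Wle _.
have -> : (L + e) * H * (N * N') = (L + e) * (N * N') * H by ring.
apply: ler_wpM2r => //.
have h1 : (L + e) * (N * (N - eta)) <= (L + e) * (N * N').
  by apply: ler_wpM2l; [exact: ltW|apply: ler_wpM2l; [exact: ltW|lra]].
apply: le_trans h1; have -> : (L + e) * (N * (N - eta)) = L * N ^+ 2 + e * N ^+ 2 / 2.
  by rewrite /eta; field; rewrite lt0r_neq0.
rewrite lerD2l; apply: (@le_trans _ _ ((K + 1) * k)).
  by apply: ler_pM => //; [lra|exact: ltW].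
by rewrite /k le_eqVlt; apply/orP; left; apply/eqP; field; rewrite lt0r_neq0 //; lra.
Qed.

Lemma chord_lipschitz a b z (L : R) : 0 <= L ->
  (forall w, modulus w <= modulus z -> nonzero (pvalue a b w) /\
    modulus (wronskian a b).[w] <= L * (modulus a.[w] ^+ 2 + modulus b.[w] ^+ 2)) ->
  chord (pvalue a b 0) (pvalue a b z) <= L * modulus z.
Proof.
move=> L0 H; have [->|z0] := eqVneq z 0.
  by rewrite chordxx mulr_ge0 ?modulus_ge0.
have m0 : 0 < modulus z by rewrite modulus_gt0.
pose g (t : R) := pvalue a b (real_complex R t * z).
apply/ler_addgt0Pr => e e0.
have e1 : 0 < e / modulus z by rewrite divr_gt0.
(* [segment_lipschitz] wants symmetry and the triangle inequality at all real parameters, whereas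
   the coordinates are known to be nonzero only over [0, 1]; clamping the parameter reconciles the
   two. *)
pose clip (t : R) := Num.max 0 (Num.min 1 t).
have clip01 t : 0 <= clip t <= 1.
  by rewrite le_max lexx /= ge_max ler01 /= ge_min lexx.
have clipE t : 0 <= t <= 1 -> clip t = t.
  by move=> /andP[t0 t1]; rewrite /clip (min_idPr t1) (max_idPr t0).
have inseg t : 0 <= t <= 1 -> modulus (real_complex R t * z) <= modulus z.
  by move=> /andP[t0 t1]; rewrite modulusM modulus_real ger0_norm // ler_piMl // ltW.
have nzg t : nonzero (g (clip t)) by have [] := H _ (inseg _ (clip01 t)).
pose D s t := chord (g (clip s)) (g (clip t)).
have : D 0 1 <= (L + e / modulus z) * modulus z.
  apply: segment_lipschitz => [|s t|s t u|t t01].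
  - by rewrite mulr_ge0 ?modulus_ge0 //; lra.
  - exact: chordC.
  - exact: chord_triangle.
  - have [nz WL] := H _ (inseg t t01).
    have [r r0 rP] := chord_local_lipschitz nz e1 L0 WL.
    exists (r / modulus z); first by rewrite divr_gt0.
    move=> u u01 ut; rewrite /D !clipE //; apply: le_trans (rP _ _) _.
      by rewrite -mulrBl -rmorphB modulusM modulus_real -ltr_pdivlMr.
    by rewrite -mulrBl -rmorphB modulusM modulus_real mulrA mulrAC -mulrA.
rewrite /D !clipE ?lexx ?ler01 // /g rmorph0 rmorph1 mul0r mul1r mulrDl divfK //.
by rewrite modulus_eq0.
Qed.

End Equicontinuity.

(** * Equicontinuity of maps omitting three values *)

Section Montel.
Variable R : realType.
Implicit Types (z w : C R) (a b c p q : {poly C R}).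

(** This and [abc_density_swap] reduce a zero of [b] or [c] to a zero of the first polynomial. *)
Lemma abc_density_rot a b c : a + b + c = 0 -> abc_density b c a = abc_density a b c.
Proof.
move=> abc; apply/funext => z; rewrite /abc_density (wronskian_bc abc).
by congr (_ * _ / _ ^+ 3); rewrite /abc_sum /abc_prod; ring.
Qed.

Lemma abc_density_swap a b c : abc_density b a c = abc_density a b c.
Proof.
apply/funext => z; rewrite /abc_density.
have -> : wronskian b a = - wronskian a b by rewrite /wronskian; ring.
rewrite hornerN modulusN.
by congr (_ * _ / _ ^+ 3); rewrite /abc_sum /abc_prod; ring.
Qed.

Definition vanishing_at0 (u : C R -> R) := forall e : R, 0 < e ->
  exists2 r : R, 0 < r & forall z, z != 0 -> modulus z < r -> u z < e.

Lemma root2_XnM q k z : root2 ('X^(k.*2) * q) z = modulus z ^+ k * root2 q z.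
Proof.
rewrite /root2 hornerM hornerXn modulusM modulusX -muln2 exprM sqrtrM ?sqr_ge0 //.
by rewrite sqrtr_sqr ger0_norm // exprn_ge0 ?modulus_ge0.
Qed.

(* A zero of order 2k contributes |z|^(2(2k-1)) to the numerator of the density
   and |z|^(3k) to its denominator. *)
Lemma abc_density_vanishing q b c k : (2 < k)%N ->
  q.[0] != 0 -> b.[0] != 0 -> c.[0] != 0 ->
  vanishing_at0 (abc_density ('X^(k.*2) * q) b c).
Proof.
case: k => // -[] // k; rewrite !ltnS => k0 q0 b0 c0 e e0.
(* The original [k] is now [k.+2], so [n] is one less than the order of the zero, and the density
   becomes |z|^k G(z) with the new [k] positive and [G] continuous at 0. *)
pose n := (k.+1.*2).+1.
pose V := n.+1%:R * (q * b) + 'X * (q^`() * b - q * b^`()).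
have WE : wronskian ('X^(n.+1) * q) b = 'X^n * V.
  rewrite /wronskian derivM derivXn /= /V -[_ *+ n.+1]mulr_natl exprS.
  by move: ('X^n) (n.+1%:R) => Y m; ring.
pose G z := modulus V.[z] ^+ 2 * abc_sum ('X^(k.+2.*2) * q) b c z / abc_prod q b c z ^+ 3.
have dE z : z != 0 -> abc_density ('X^(k.+2.*2) * q) b c z = modulus z ^+ k * G z.
  move=> z0; have m0 : modulus z != 0 by rewrite modulus_eq0.
  rewrite /abc_density /G doubleS -/n WE hornerM hornerXn modulusM modulusX.
  set S := abc_sum _ _ _ _.
  have -> : abc_prod ('X^(n.+1) * q) b c z = modulus z ^+ k.+2 * abc_prod q b c z.
    by rewrite /abc_prod /n -doubleS root2_XnM; ring.
  set T := modulus z ^+ k.+2; set P := abc_prod q b c z.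
  have t0 : T ^+ 3 != 0 by rewrite !expf_neq0.
  have -> : (modulus z ^+ n * modulus V.[z]) ^+ 2 = modulus z ^+ k * T ^+ 3 * modulus V.[z] ^+ 2.
    rewrite exprMn; congr (_ * _); rewrite /T.
    by rewrite -!exprM -exprD; congr (_ ^+ _); rewrite /n -muln2; lia.
  have -> : (T * P) ^+ 3 = T ^+ 3 * P ^+ 3 by exact: exprMn.
  move: t0; move: (T ^+ 3) (P ^+ 3) (modulus z ^+ k) (modulus V.[z] ^+ 2) => t P3 u v t0.
  have -> : u * (v * S / P3) = u * v * S * P3^-1 by ring.
  have -> : u * t * v * S / (t * P3) = (t / t) * (u * v * S * P3^-1) by rewrite invfM; ring.
  by rewrite divff // mul1r.
have Gc : {for 0, continuous G}.
  have cr (p : {poly C R}) : root2 p x @[x --> (0 : C R)] --> root2 p 0.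
    exact: continuous_root2.
  have HW : modulus V.[x] ^+ 2 @[x --> (0 : C R)] --> modulus V.[0] ^+ 2.
    exact: expansion2_continuous (expansion2_modulus_sqr _ 0).
  have HS : abc_sum ('X^(k.+2.*2) * q) b c x @[x --> (0 : C R)] -->
      abc_sum ('X^(k.+2.*2) * q) b c 0.
    exact: cvgD (cvgD (cr _) (cr b)) (cr c).
  have HP : abc_prod q b c x @[x --> (0 : C R)] --> abc_prod q b c 0.
    exact: cvgM (cvgM (cr q) (cr b)) (cr c).
  have HP3 : abc_prod q b c x ^+ 3 @[x --> (0 : C R)] --> abc_prod q b c 0 ^+ 3.
    by apply: cvg_exprn HP.
  apply: (cvgM (cvgM HW HS)); apply: cvgV HP3.
  by rewrite lt0r_neq0 ?exprn_gt0 ?abc_prod_gt0.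
have /continuous_modulusP/(_ _ ltr01)[r r0 rP] := Gc.
pose K := `|G 0| + 1; have K0 : 0 < K by rewrite ltr_wpDl.
exists (Num.min (Num.min r 1) (e / K)); first by rewrite !lt_min r0 ltr01 divr_gt0.
move=> z z0; rewrite !lt_min -andbA => /and3P[zr z1 ze].
rewrite dE //; have := rP z; rewrite subr0 => /(_ zr) Gz.
have GK : `|G z| <= K.
  by rewrite -[G z](subrK (G 0)); apply: le_trans (ler_normD _ _) _; rewrite /K; lra.
apply: le_lt_trans (ler_norm _) _; rewrite normrM ger0_norm ?exprn_ge0 ?modulus_ge0 //.
apply: (@le_lt_trans _ _ (modulus z * K)); last by rewrite -ltr_pdivlMr.
apply: ler_pM; rewrite ?exprn_ge0 ?modulus_ge0 //.
by rewrite -{2}(expr1 (modulus z)) ler_wiXn2l ?modulus_ge0 // ltW.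
Qed.

Section PowerSubstitution.
Variable w0 : C R.

(** The exponent 8 makes a zero of order m at [w0] one of order 8 m = 2 k with k = 4 m > 2, as
    [abc_density_vanishing] requires. *)
Let P : {poly C R} := 'X^8 + w0%:P.

Lemma wronskian_comp a b p :
  wronskian (a \Po p) (b \Po p) = (wronskian a b \Po p) * p^`().
Proof. by rewrite /wronskian !deriv_comp comp_polyB !comp_polyM; ring. Qed.

Let hornerP a z : (a \Po P).[z] = a.[w0 + z ^+ 8].
Proof. by rewrite horner_comp /P !hornerE addrC. Qed.

Let wronskian0 a b : (wronskian (a \Po P) (b \Po P)).[0] = 0.
Proof.
rewrite wronskian_comp hornerM /P poly.derivD derivC derivXn addr0 hornerMn hornerXn.
by rewrite expr0n mul0rn mulr0.
Qed.

Let vanishing_zero a b c : a != 0 -> a.[w0] = 0 -> b.[w0] != 0 -> c.[w0] != 0 ->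
  vanishing_at0 (abc_density (a \Po P) (b \Po P) (c \Po P)).
Proof.
move=> a0 aw bw cw; have [m [q qw aE]] := multiplicity_XsubC a w0.
rewrite a0 /= in qw.
have m0 : (0 < m)%N.
  rewrite lt0n; apply/eqP => m0; move: aw qw; rewrite aE m0 expr0 mulr1.
  by rewrite /root => ->; rewrite eqxx.
have -> : a \Po P = 'X^((4 * m).*2) * (q \Po P).
  rewrite aE comp_polyM mulrC; congr (_ * _).
  have -> : ('X - w0%:P) ^+ m \Po P = (('X - w0%:P) \Po P) ^+ m.
    by elim: (m) => [|k IH]; rewrite ?expr0 ?comp_polyC // !exprS comp_polyM IH.
  rewrite comp_polyB comp_polyX comp_polyC /P addrK -exprM.
  by congr ('X^_); rewrite -muln2; lia.
apply: abc_density_vanishing; rewrite ?hornerP ?expr0n ?addr0 //.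
by lia.
Qed.

(** As a + b + c = 0 and (a, b) does not vanish at [w0], at most one of the three is zero there. If
    none is, the density still vanishes at 0, because the Wronskian of the compositions contains the
    derivative 8 z^7 of the substitution. *)
Lemma abc_density_comp_vanishing a b c : a + b + c = 0 ->
  a != 0 -> b != 0 -> c != 0 -> nonzero (pvalue a b w0) ->
  vanishing_at0 (abc_density (a \Po P) (b \Po P) (c \Po P)).
Proof.
move=> abc a0 b0 c0; rewrite /nonzero /= => nz.
have abcP : (a \Po P) + (b \Po P) + (c \Po P) = 0.
  by rewrite -!comp_polyD abc comp_poly0.
have abw : a.[w0] + b.[w0] + c.[w0] = 0 by rewrite -!hornerD abc horner0.
have [aw|aw] := eqVneq a.[w0] 0.
  rewrite aw eqxx /= in nz; apply: vanishing_zero => //.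
  by move: abw; rewrite aw add0r => /eqP; rewrite addrC addr_eq0 => /eqP ->; rewrite oppr_eq0.
have [bw|bw] := eqVneq b.[w0] 0.
  rewrite -abc_density_swap; apply: vanishing_zero => //.
  by move: abw; rewrite bw addr0 => /eqP; rewrite addrC addr_eq0 => /eqP ->; rewrite oppr_eq0.
have [cw|cw] := eqVneq c.[w0] 0.
  have <- : abc_density (c \Po P) (a \Po P) (b \Po P) =
      abc_density (a \Po P) (b \Po P) (c \Po P).
    by apply: esym; rewrite abc_density_rot // -abcP; ring.
  exact: vanishing_zero.
move=> e e0; have H : {for 0, continuous (abc_density (a \Po P) (b \Po P) (c \Po P))}.
  by apply: continuous_abc_density; rewrite hornerP expr0n addr0.
have /continuous_modulusP/(_ _ e0)[r r0 rP] := H.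
exists r => // z _ zr; have := rP z; rewrite subr0 => /(_ zr).
rewrite {2}/abc_density wronskian0 modulus0 expr0n !mul0r subr0.
by rewrite ger0_norm // abc_density_ge0.
Qed.

End PowerSubstitution.

Lemma root8_exists w : exists z, z ^+ 8 = w.
Proof.
exists (sqrtc (sqrtc (sqrtc w))).
by rewrite (exprM _ 4 2) (exprM _ 2 2) !sqr_sqrtc.
Qed.

(* The substitution w0 + z^8 turns a possible singularity of the density at w0
   into a zero, so that the Ahlfors bound holds on a full disc. *)
Lemma chord_equicontinuous (r e : R) : 0 < r -> 0 < e ->
  exists2 delta : R, 0 < delta & forall a b w0, coprimep a b ->
    (forall z, z != w0 -> modulus (z - w0) < r ->
      [/\ a.[z] != 0, b.[z] != 0 & (a + b).[z] != 0]) ->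
    forall w, modulus (w - w0) < delta -> chord (pvalue a b w0) (pvalue a b w) < e.
Proof.
move=> r0 e0; pose s := Num.min 1 (r / 2).
have s0 : 0 < s by rewrite lt_min ltr01 divr_gt0.
have s1 : s <= 1 by rewrite ge_min lexx.
have sr : s <= r / 2 by rewrite ge_min lexx orbT.
have s8 z : modulus z <= s -> modulus (z ^+ 8) < r.
  move=> zs; rewrite modulusX; apply: (@le_lt_trans _ _ (modulus z)); last by lra.
  by rewrite -{2}(expr1 (modulus z)) ler_wiXn2l ?modulus_ge0 //; lra.
(* For |v| <= s / 2 one has s^2 - |v|^2 >= s^2 / 2, so the Ahlfors bound gives a density at most 4 *
   288 / s^2 <= (40 / s)^2; the factor 128 is that of [spherical_derivative_le]. *)
pose L := 128 * (40 / s); have L0 : 0 < L by rewrite mulr_gt0 // divr_gt0.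
pose eta := Num.min (s / 2) (e / L).
have eta0 : 0 < eta by rewrite lt_min !divr_gt0.
(* An eighth root of w - w0 then has modulus below [eta], whatever [a], [b] and [w0] are. *)
exists (eta ^+ 8); first exact: exprn_gt0.
move=> a b w0 ab nz w ww; pose c := - (a + b).
have abc : a + b + c = 0 by rewrite /c subrr.
pose P : {poly C R} := 'X^8 + w0%:P.
have hP p z : (p \Po P).[z] = p.[w0 + z ^+ 8] by rewrite horner_comp /P !hornerE addrC.
have nzP z : z != 0 -> modulus z <= s ->
    [/\ (a \Po P).[z] != 0, (b \Po P).[z] != 0 & (c \Po P).[z] != 0].
  move=> z0 zs; have [] := nz (w0 + z ^+ 8).
  - by rewrite -subr_eq0 addrC addKr expf_neq0.
  - by rewrite addrC addKr s8.
  by rewrite !hP /c hornerN oppr_eq0.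
have sC : modulus (real_complex R s : C R) <= s by rewrite modulus_real ger0_norm // ltW.
have sC0 : (real_complex R s : C R) != 0 by rewrite -modulus_gt0 modulus_real gtr0_norm.
have [a0 b0 c0] : [/\ a != 0, b != 0 & c != 0].
  have [] := nzP _ sC0 sC; rewrite !hP => h1 h2 h3.
  by split; [move: h1|move: h2|move: h3]; apply: contra_neq => ->; rewrite horner0.
have abcP : (a \Po P) + (b \Po P) + (c \Po P) = 0.
  by rewrite -!comp_polyD abc comp_poly0.
have nzw v : nonzero (pvalue a b v) by exact: pvalue_nonzero.
have bound := ahlfors_bound abcP s0 nzP (abc_density_comp_vanishing abc a0 b0 c0 (nzw w0)).
have [z zE] := root8_exists (w - w0).
have zeta : modulus z < eta.
  rewrite -(@ltr_pXn2r _ 8) ?nnegrE ?modulus_ge0 ?(ltW eta0) //.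
  by rewrite -modulusX zE.
have zs : modulus z < s / 2 by apply: lt_le_trans zeta _; rewrite ge_min lexx.
have pE v : pvalue (a \Po P) (b \Po P) v = pvalue a b (w0 + v ^+ 8) by rewrite /pvalue !hP.
have -> : chord (pvalue a b w0) (pvalue a b w) =
    chord (pvalue (a \Po P) (b \Po P) 0) (pvalue (a \Po P) (b \Po P) z).
  by rewrite !pE expr0n addr0 zE addrC subrK.
apply: (@le_lt_trans _ _ (L * modulus z)); last first.
  rewrite mulrC -ltr_pdivlMr //; apply: lt_le_trans zeta _.
  by rewrite ge_min lexx orbT.
apply: chord_lipschitz; first exact: ltW.
move=> v vz; split; first by rewrite pE.
have [->|v0] := eqVneq v 0.
  rewrite wronskian_comp hornerM /P poly.derivD derivC derivXn addr0 hornerMn hornerXn.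
  rewrite expr0n mul0rn mulr0 modulus0 mulr_ge0 ?(ltW L0) //.
  by rewrite addr_ge0 ?sqr_ge0.
have vs : modulus v <= s by lra.
have [av bv cv] := nzP v v0 vs.
have := bound v v0 vs; rewrite /ahlfors_ratio => hb.
have := spherical_derivative_le abcP av bv cv.
set N := _ + _; set W := modulus _; set d := abc_density _ _ _ _ in hb * => hd.
have N0 : 0 < N by rewrite addr_gt0 // exprn_gt0 // modulus_gt0.
have d0 : 0 <= d by exact: abc_density_ge0.
rewrite -ler_pdivrMr //.
rewrite -(@ler_pXn2r _ 2) ?nnegrE ?divr_ge0 ?modulus_ge0 ?(ltW L0) ?(ltW N0) //.
apply: le_trans hd _; rewrite exprMn.
apply: ler_wpM2l; first exact: sqr_ge0.
have v2 : s ^+ 2 / 2 <= s ^+ 2 - modulus v ^+ 2.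
  have : modulus v ^+ 2 <= (s / 2) ^+ 2.
    by apply: lerXn2r; rewrite ?nnegrE ?modulus_ge0; lra.
  have -> : (s / 2) ^+ 2 = s ^+ 2 / 4 by field.
  by have := exprn_gt0 2 s0; lra.
have s20 : 0 < s ^+ 2 by exact: exprn_gt0.
have v4 : (s ^+ 2 / 2) ^+ 2 <= (s ^+ 2 - modulus v ^+ 2) ^+ 2.
  by apply: lerXn2r; rewrite ?nnegrE; lra.
have h1 : d * (s ^+ 2 / 2) ^+ 2 <= 288 * s ^+ 2.
  by apply: le_trans hb; apply: ler_wpM2l.
have -> : (40 / s) ^+ 2 = 1600 / s ^+ 2 by field; rewrite lt0r_neq0.
rewrite ler_pdivlMr //.
have h2 : d * s ^+ 2 * s ^+ 2 <= 1152 * s ^+ 2.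
  have -> : d * s ^+ 2 * s ^+ 2 = 4 * (d * (s ^+ 2 / 2) ^+ 2) by field.
  by lra.
by move: h2; rewrite ler_pM2r // => h2; lra.
Qed.

End Montel.

(** * Independence polynomials of Cayley trees *)

Section CayleyRecurrence.
Variables (d n : nat).

Local Notation V m := (m.-bseq 'I_d).
Local Notation T m := (cayley_tree d m).

Lemma independentP (G : sgraph) (I : {set G}) :
  reflect (forall x y, x \in I -> y \in I -> ~~ adj x y) (independent I).
Proof.
apply: (iffP forall_inP) => [H x y xI yI|H x xI].
  exact: (forall_inP (H x xI)).
by apply/forall_inP => y yI; exact: H.
Qed.

(** Embedding of the tree of depth n as the subtree hanging from the i-th child of the root. *)
Definition graft (i : 'I_d) (s : V n) : V n.+1 := [bseq of i :: val s].

Definition graft_inv (t : seq 'I_d) : V n := insub_bseq n t.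

Lemma graft_invK (s : V n) : graft_inv (val s) = s.
Proof. by apply: val_inj; rewrite /graft_inv /insub_bseq insubdK // -topredE /= size_bseq. Qed.

Lemma graft_cases (t : V n.+1) : t = [bseq] \/ exists i s, t = graft i s.
Proof.
case: t => -[|i s] ts; [left|right]; first exact: val_inj.
by exists i, (@Bseq n _ s ts); apply: val_inj.
Qed.

(** A vertex set of the deeper tree is encoded by its trace on the root and its traces on the d
    subtrees. *)
Definition graft_sets (b : bool) (f : {ffun 'I_d -> {set V n}}) : {set V n.+1} :=
  [set t : V n.+1 | if val t is i :: s then graft_inv s \in f i else b].

Lemma in_graft_sets b f i s : (graft i s \in graft_sets b f) = (s \in f i).
Proof. by rewrite inE /= graft_invK. Qed.

Lemma root_in_graft_sets b f : ([bseq] \in graft_sets b f) = b.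
Proof. by rewrite inE. Qed.

Lemma sum_graft (F : V n.+1 -> nat) :
  (\sum_t F t = F [bseq] + \sum_(i < d) \sum_(s : V n) F (graft i s))%N.
Proof.
rewrite (bigD1 [bseq]) //=; congr (_ + _)%N.
rewrite pair_big /=.
pose h (p : 'I_d * V n) := graft p.1 p.2.
have hinj : injective h.
  by move=> [i s] [j t] /(congr1 val) [-> /val_inj ->].
have -> : (\sum_(p : 'I_d * V n) F (graft p.1 p.2) =
    \sum_(t in map h (enum {: 'I_d * V n})) F t)%N.
  have U : uniq (map h (enum {: 'I_d * V n})) by rewrite map_inj_uniq ?enum_uniq.
  by rewrite -(big_uniq _ U) big_map big_enum.
apply: eq_bigl => t; apply/idP/mapP => [t0|[p _ ->]] //.
case: (graft_cases t) t0 => [-> //|[i [s ->]] _]; exists (i, s) => //.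
by rewrite mem_enum.
Qed.

Lemma card_graft_sets b f : #|graft_sets b f| = (b + \sum_i #|f i|)%N.
Proof.
rewrite -sum1_card big_mkcond /= sum_graft root_in_graft_sets; congr (_ + _)%N.
apply: eq_bigr => i _; rewrite -sum1_card [RHS]big_mkcond /=.
by apply: eq_bigr => s _; rewrite in_graft_sets.
Qed.

Lemma is_child_graft i j s t :
  is_child (graft i s) (graft j t) = (i == j) && is_child s t.
Proof.
apply/existsP/andP => [[k /= /eqP[-> E]]|[/eqP <- /existsP[k /eqP E]]].
  by split=> //; apply/existsP; exists k; apply/eqP.
by exists k; rewrite /= E.
Qed.

Lemma cayley_adj_graft i j s t :
  cayley_adj (graft i s) (graft j t) = (i == j) && cayley_adj s t.
Proof.
by rewrite /cayley_adj !is_child_graft [j == i]eq_sym -andb_orr.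
Qed.

Lemma cayley_adj_root i s : cayley_adj [bseq] (graft i s) = (s == [bseq]).
Proof.
rewrite /cayley_adj; have -> : is_child (graft i s) [bseq] = false.
  by apply/existsP => -[k].
rewrite orbF; apply/existsP/eqP => [[k /= /eqP[_ E]]|->]; first exact: val_inj.
by exists i.
Qed.

(** Distinct subtrees are not joined, and the root of the tree is adjacent exactly to the roots of
    the subtrees. *)
Lemma independent_graft b f : @independent (T n.+1) (graft_sets b f) =
  [forall i, @independent (T n) (f i) && (b ==> ([bseq] \notin f i))].
Proof.
apply/independentP/forallP => /= H.
  move=> i; apply/andP; split.
    apply/independentP => s t /= sI tI.
    have := H (graft i s) (graft i t); rewrite !in_graft_sets cayley_adj_graft eqxx.
    exact.
  apply/implyP => b1; apply/negP => rI.
  have := H [bseq] (graft i [bseq]); rewrite in_graft_sets root_in_graft_sets.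
  by rewrite cayley_adj_root eqxx => /(_ b1 rI).
move=> x y; case: (graft_cases x) => [->|[i [s ->]]]; case: (graft_cases y) => [->|[j [t ->]]].
- by move=> _ _; rewrite cayley_adj_irrefl.
- rewrite root_in_graft_sets in_graft_sets cayley_adj_root => b1 tI.
  have /andP[_] := H j; rewrite b1 /=; apply: contra => /eqP <-; exact: tI.
- rewrite root_in_graft_sets in_graft_sets cayley_adj_sym cayley_adj_root => sI b1.
  have /andP[_] := H i; rewrite b1 /=; apply: contra => /eqP <-; exact: sI.
- rewrite !in_graft_sets cayley_adj_graft => sI tI.
  case: eqP => [ij|] //=; rewrite -ij in tI.
  by have /andP[/independentP Hi _] := H i; exact: Hi.
Qed.

Lemma big_graft (K : nzRingType) b (F : {set V n.+1} -> {poly K}) :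
  \sum_(I : {set V n.+1} | @independent (T n.+1) I && (([bseq] \in I) == b)) F I =
  \sum_(f : {ffun 'I_d -> {set V n}} |
    [forall i, @independent (T n) (f i) && (b ==> ([bseq] \notin f i))]) F (graft_sets b f).
Proof.
pose h' (I : {set V n.+1}) : {ffun 'I_d -> {set V n}} :=
  [ffun i => [set s : V n | graft i s \in I]%SET].
rewrite (reindex_onto (graft_sets b) h') => [|I /andP[_ /eqP rI]]; last first.
  apply/setP => t; case: (graft_cases t) => [->|[i [s ->]]].
    by rewrite root_in_graft_sets.
  by rewrite in_graft_sets ffunE inE.
apply: eq_bigl => f; rewrite independent_graft root_in_graft_sets eqxx andbT.
rewrite andbC; have -> : h' (graft_sets b f) == f by
  apply/eqP/ffunP => i; apply/setP => s; rewrite ffunE inE in_graft_sets.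
by [].
Qed.

Variable K : nzRingType.

Lemma indep_poly_split (G : rooted_graph) :
  indep_poly K G = indep_poly_in K G + indep_poly_out K G.
Proof. by rewrite /indep_poly (bigID (fun I : {set G} => rt G \in I)). Qed.

End CayleyRecurrence.

(** * Recurrences for the independence polynomials *)

Section CayleyPolynomials.
Variables (d : nat) (K : comNzRingType).

(** Expanding the power by distributivity amounts to choosing one set in each of the d subtrees. *)
Lemma prod_indep_poly n (Q : pred {set n.-bseq 'I_d}) :
  \sum_(f : {ffun 'I_d -> {set n.-bseq 'I_d}} | [forall i, Q (f i)])
    \prod_i 'X^#|f i| = (\sum_(I | Q I) 'X^#|I|) ^+ d :> {poly K}.
Proof.
have E (p : {poly K}) : p ^+ d = \prod_(i < d) p by rewrite prodr_const card_ord.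
rewrite E bigA_distr_big.
by apply: eq_bigl => f; apply/forallP/ffun_onP.
Qed.

Lemma indep_poly_inS n : indep_poly_in K (cayley_tree d n.+1) =
  'X * indep_poly_out K (cayley_tree d n) ^+ d.
Proof.
rewrite -prod_indep_poly big_distrr /=.
transitivity (\sum_(I : {set n.+1.-bseq 'I_d} |
    @independent (cayley_tree d n.+1) I && (([bseq] \in I) == true)) ('X^#|I| : {poly K})).
  by apply: eq_bigl => I; rewrite eqb_id.
rewrite big_graft; apply: eq_bigr => f _.
by rewrite card_graft_sets exprD expr1 expr_sum.
Qed.

Lemma indep_poly_outS n : indep_poly_out K (cayley_tree d n.+1) =
  indep_poly K (cayley_tree d n) ^+ d.
Proof.
rewrite -prod_indep_poly.
transitivity (\sum_(I : {set n.+1.-bseq 'I_d} |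
    @independent (cayley_tree d n.+1) I && (([bseq] \in I) == false)) ('X^#|I| : {poly K})).
  by apply: eq_bigl => I; rewrite eqbF_neg.
rewrite big_graft; apply: eq_big => [f|f _].
  by apply: eq_forallb => i; rewrite andbT.
by rewrite card_graft_sets add0n expr_sum.
Qed.

Lemma bseq0_set (I : {set 0.-bseq 'I_d}) : I = (if [bseq] \in I then [set [bseq]] else finset.set0)%SET.
Proof.
have E (t : 0.-bseq 'I_d) : t = [bseq] by apply: val_inj; case: t => -[].
by case: ifP => rI; apply/setP => t; rewrite (E t) !inE rI.
Qed.

Lemma indep_poly_in0 : indep_poly_in K (cayley_tree d 0) = 'X.
Proof.
rewrite /indep_poly_in (big_pred1 ([set [bseq]]%SET : {set cayley_tree d 0})) ?cards1 //.
move=> I /=; apply/andP/eqP => [[_ rI]|->].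
  by rewrite (bseq0_set I) rI.
split; last by rewrite inE.
by apply/independentP => x y; rewrite !inE => /eqP -> /eqP ->; rewrite adj_irrefl.
Qed.

Lemma indep_poly_out0 : indep_poly_out K (cayley_tree d 0) = 1.
Proof.
rewrite /indep_poly_out (big_pred1 (finset.set0 : {set cayley_tree d 0})) ?cards0 //.
move=> I /=; apply/andP/eqP => [[_ /negbTE rI]|->].
  by rewrite (bseq0_set I) rI.
split; last by rewrite inE.
by apply/independentP => x y; rewrite !inE.
Qed.

End CayleyPolynomials.

(** * The orbit of 0 under w |-> z / (1 + w)^d *)

Section Dynamics.
Variables (R : realType) (d : nat).
Hypothesis d2 : (2 <= d)%N.
Implicit Types (z w : C R) (n p k : nat).

Definition cayley_in n := indep_poly_in (C R) (cayley_tree d n).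
Definition cayley_out n := indep_poly_out (C R) (cayley_tree d n).

Local Notation P := cayley_in.
Local Notation Q := cayley_out.

Let d0 : (0 < d)%N. Proof. exact: leq_trans d2. Qed.

Lemma indep_poly_cayley n : indep_poly (C R) (cayley_tree d n) = P n + Q n.
Proof. exact: indep_poly_split. Qed.

Lemma cayley_in0 : P 0 = 'X. Proof. exact: indep_poly_in0. Qed.

Lemma cayley_out0 : Q 0 = 1. Proof. exact: indep_poly_out0. Qed.

Lemma cayley_inS n : P n.+1 = 'X * Q n ^+ d. Proof. exact: indep_poly_inS. Qed.

Lemma cayley_outS n : Q n.+1 = (P n + Q n) ^+ d.
Proof. by rewrite /Q indep_poly_outS indep_poly_cayley. Qed.

(** At activity 0 only the empty set has nonzero weight. These values later show that various
    polynomials are nonzero. *)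
Lemma cayley_at0 n : (P n).[0] = 0 /\ (Q n).[0] = 1.
Proof.
elim: n => [|n [IP IQ]]; first by rewrite cayley_in0 cayley_out0 !hornerE.
rewrite cayley_inS cayley_outS hornerM hornerX mul0r; split=> //.
by rewrite horner_exp hornerD IP IQ add0r expr1n.
Qed.

(** In the inductive step, X is prime to P + Q, whose value at 0 is 1, and Q is prime to P + Q
    because it is prime to P. *)
Lemma coprimep_cayley n : coprimep (P n) (Q n).
Proof.
elim: n => [|n IH]; first by rewrite cayley_out0 coprimep1.
rewrite cayley_inS cayley_outS coprimep_expr // coprimepMl; apply/andP; split.
  rewrite coprimep_sym -['X]subr0 coprimep_XsubC /root hornerD.
  by have [-> ->] := cayley_at0 n; rewrite add0r oner_eq0.
apply: coprimep_expl; rewrite -[P n]mulr1 -[X in _ + X]mul1r addrC coprimep_addl_mul mulr1.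
by rewrite coprimep_sym.
Qed.

(** The difference R_n - R_(n+p) cleared of denominators; it vanishes at z exactly when the two
    ratios agree there as points of the sphere. *)
Definition cayley_wedge p n : {poly C R} := P n * Q (n + p)%N - P (n + p)%N * Q n.

Lemma cayley_wedgeS p n : cayley_wedge p n.+1 = - 'X * cayley_wedge p n *
  \sum_(i < d) (Q n * (P (n + p)%N + Q (n + p)%N)) ^+ (d.-1 - i) *
                 (Q (n + p)%N * (P n + Q n)) ^+ i.
Proof.
rewrite /cayley_wedge addSn !cayley_inS !cayley_outS.
have -> : 'X * Q n ^+ d * (P (n + p)%N + Q (n + p)%N) ^+ d -
    'X * Q (n + p)%N ^+ d * (P n + Q n) ^+ d =
    'X * ((Q n * (P (n + p)%N + Q (n + p)%N)) ^+ d - (Q (n + p)%N * (P n + Q n)) ^+ d).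
  by rewrite !exprMn; ring.
by rewrite subrXX mulrA; congr (_ * _); ring.
Qed.

Lemma dvdp_cayley_wedge p n m : (n <= m)%N -> cayley_wedge p n %| cayley_wedge p m.
Proof.
move=> /subnK <-; elim: (m - n)%N => [|k IH]; first exact: dvdpp.
rewrite addSn cayley_wedgeS; apply: dvdp_trans IH _.
by rewrite mulrAC mulrC dvdp_mulr // dvdpp.
Qed.

(** The map w |-> z / (1 + w)^d has local degree d at -1, so contact of the two ratios at -1 gains
    order. Concretely, each summand of the cofactor in [cayley_wedgeS] has total exponent d - 1 >= 1
    in quantities vanishing at z. *)
Lemma dvdp_cayley_wedge_step p n m z :
  (P n + Q n).[z] = 0 -> (P (n + p)%N + Q (n + p)%N).[z] = 0 ->
  ('X - z%:P) ^+ m %| cayley_wedge p n -> ('X - z%:P) ^+ m.+1 %| cayley_wedge p n.+1.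
Proof.
move=> S0 S'0 mD; rewrite cayley_wedgeS exprSr.
apply: dvdp_mul; first by rewrite dvdp_mull.
rewrite dvdp_XsubCl /root horner_sum big1 // => i _.
rewrite hornerM !horner_exp !hornerM S0 S'0 !mulr0 !expr0n.
case: (nat_of_ord i) => [|k]; last by rewrite mulr0.
by rewrite subn0; case: d d2 => // -[] // k _; rewrite mul0r.
Qed.

(** Factoring a difference of d-th powers gives X P_(p-1) times a sum whose value at 0 is d. Hence
    only finitely many parameters give the orbit of 0 the period p. *)
Lemma cayley_wedge0_neq0 p : (1 < p)%N -> cayley_wedge p 0 != 0.
Proof.
case: p => // -[] // p _; rewrite /cayley_wedge add0n cayley_in0 cayley_out0 mulr1.
rewrite cayley_inS cayley_outS -mulrBr subrXX addrK cayley_inS.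
rewrite !mulf_neq0 ?polyX_eq0 ?expf_neq0 //.
  apply/eqP => E; have [_] := cayley_at0 p; rewrite E horner0 => /eqP.
  by rewrite eq_sym oner_eq0.
apply/eqP => /(congr1 (horner^~ 0)); rewrite horner0 horner_sum.
rewrite (eq_bigr (fun=> 1)) => [|i _]; last first.
  rewrite hornerM !horner_exp hornerD -cayley_inS.
  by have [-> ->] := cayley_at0 p.+1; rewrite add0r !expr1n mulr1.
rewrite sumr_const card_ord => /eqP.
by rewrite pnatr_eq0 gtn_eqF.
Qed.

Definition cayley_point n z : C R * C R := pvalue (P n) (Q n) z.

Lemma cayley_point_nonzero n z : nonzero (cayley_point n z).
Proof. by apply: pvalue_nonzero; exact: coprimep_cayley. Qed.

Lemma wedge_cayley_point p n z :
  wedge (cayley_point n z) (cayley_point (n + p) z) = (cayley_wedge p n).[z].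
Proof. by rewrite /wedge /cayley_wedge /= !hornerE; ring. Qed.

Definition proportional (u v : C R * C R) :=
  exists2 t : C R, t != 0 & v = (t * u.1, t * u.2).

Lemma proportional_step n m z : proportional (cayley_point n z) (cayley_point m z) ->
  proportional (cayley_point n.+1 z) (cayley_point m.+1 z).
Proof.
move=> [t t0 [E1 E2]]; exists (t ^+ d); first by rewrite expf_neq0.
rewrite /cayley_point /pvalue /= !cayley_inS !cayley_outS !hornerM !horner_exp !hornerD E1 E2 /=.
by rewrite -mulrDr !exprMn; congr (_, _); ring.
Qed.

Section Periodic.
Variables (N : nat) (z : C R).
Hypothesis zN : (P N + Q N).[z] = 0.

Lemma cayley_zero_neq0 : z != 0.
Proof.
apply/eqP => z0; move: zN; rewrite z0 hornerD.
by have [-> ->] := cayley_at0 N; rewrite add0r => /eqP; rewrite oner_eq0.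
Qed.

(* The orbit of 0 under w |-> z / (1 + w)^d runs through -1, oo and back to 0. *)
Lemma cayley_periodic n : proportional (cayley_point n z) (cayley_point (n + N.+3) z).
Proof.
elim: n => [|n IH]; last by rewrite addSn; exact: proportional_step.
have z0 := cayley_zero_neq0.
have QN : (Q N).[z] != 0.
  apply/eqP => QN; move: zN; rewrite hornerD QN addr0 => PN.
  by have := cayley_point_nonzero N z; rewrite /nonzero /= PN QN eqxx.
have Q1 : (Q N.+1).[z] = 0 by rewrite cayley_outS horner_exp zN expr0n gtn_eqF.
have P1 : (P N.+1).[z] != 0.
  by rewrite cayley_inS hornerM hornerX horner_exp mulf_neq0 ?expf_neq0.
have P2 : (P N.+2).[z] = 0.
  by rewrite cayley_inS hornerM horner_exp Q1 expr0n gtn_eqF // mulr0.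
have Q2 : (Q N.+2).[z] != 0.
  by rewrite cayley_outS horner_exp hornerD Q1 addr0 expf_neq0.
exists ((Q N.+2).[z] ^+ d); first by rewrite expf_neq0.
rewrite add0n /cayley_point /pvalue (cayley_inS N.+2) (cayley_outS N.+2) hornerM !horner_exp hornerD P2 add0r.
by rewrite cayley_in0 cayley_out0 !hornerE /= mulrC.
Qed.

Lemma cayley_periodic_mul n k :
  proportional (cayley_point n z) (cayley_point (n + N.+3 * k) z).
Proof.
elim: k => [|k [t t0 E]].
  by exists 1; rewrite ?oner_eq0 // !mul1r muln0 addn0 -surjective_pairing.
have [u u0 E'] := cayley_periodic (n + N.+3 * k).
exists (u * t); first by rewrite mulf_neq0.
have -> : (n + N.+3 * k.+1)%N = (n + N.+3 * k + N.+3)%N by lia.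
by rewrite E' E /= !mulrA.
Qed.

Lemma cayley_zero_mul k : (P (N + N.+3 * k)%N + Q (N + N.+3 * k)%N).[z] = 0.
Proof.
have [t _ [E1 E2]] := cayley_periodic_mul N k.
by rewrite hornerD E1 E2 -mulrDr -hornerD zN mulr0.
Qed.

(** The order of vanishing at z never decreases with n, and it grows by at least one each time the
    orbit returns to -1, that is, at the indices N + (N + 3) k. *)
Lemma cayley_wedge_order m : exists n0, forall n, (n0 <= n)%N ->
  ('X - z%:P) ^+ m %| cayley_wedge N.+3 n.
Proof.
elim: m => [|m [n0 IH]]; first by exists 0%N => n _; rewrite expr0 dvd1p.
exists (N + N.+3 * n0).+1 => n nle.
apply: dvdp_trans (dvdp_cayley_wedge _ nle).
apply: dvdp_cayley_wedge_step; first exact: cayley_zero_mul.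
  by have := cayley_zero_mul n0.+1; rewrite mulnSr addnA.
by apply: IH; lia.
Qed.

(** A zero at index n would persist to the index (N + 3) n >= n, where by periodicity the two points
    are again those of indices 0 and p. *)
Lemma cayley_wedge_neq0 p n : (cayley_wedge p 0).[z] != 0 -> (cayley_wedge p n).[z] != 0.
Proof.
apply: contra_neq => Dn.
have nle : (n <= N.+3 * n)%N by lia.
have /dvdpP[q qE] := dvdp_cayley_wedge p nle.
have {qE} : (cayley_wedge p (N.+3 * n)).[z] = 0 by rewrite qE hornerM Dn mulr0.
have [t t0 E] := cayley_periodic_mul 0 n.
have [u u0 E'] := cayley_periodic_mul p n.
rewrite -!wedge_cayley_point add0n [(N.+3 * n + p)%N]addnC -[(N.+3 * n)%N]add0n E add0n E' /wedge /=.
move=> H; apply/eqP; have : t * u * ((P 0).[z] * (Q p).[z] - (Q 0).[z] * (P p).[z]) == 0.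
  by rewrite -[X in _ == X]H; apply/eqP; ring.
by rewrite !mulf_eq0 (negbTE t0) (negbTE u0).
Qed.

End Periodic.
End Dynamics.

(** * Normality *)

Section Ascoli.
Variable R : realType.
Implicit Types (z w : C R) (s t : sphere R).

Lemma half_chord_triangle (s t u : sphere R) :
  half_chord s u <= half_chord s t + half_chord t u.
Proof. by rewrite !half_chordE chord_triangle ?coords_nonzero. Qed.

Lemma half_chordC s t : half_chord s t = half_chord t s.
Proof. by rewrite !half_chordE chordC. Qed.

Lemma pnorm_ge1 z : 1 <= pnorm (z, 1) /\ 1 <= pnorm (1, z).
Proof.
have E : pnorm (1, z) = pnorm (z, 1) by rewrite /pnorm /= addrC.
rewrite E; suff : 1 <= pnorm (z, 1) by [].
rewrite -(@ler_pXn2r _ 2) ?nnegrE ?pnorm_ge0 // pnorm_sqr modulus1 !expr1n.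
by rewrite lerDr sqr_ge0.
Qed.

Lemma chord_affine z w :
  chord (z, 1) (w, 1) <= modulus (z - w) /\ chord (1, z) (1, w) <= modulus (z - w).
Proof.
have [z1 z2] := pnorm_ge1 z; have [w1 w2] := pnorm_ge1 w.
have H (x y : R) : 1 <= x -> 1 <= y -> modulus (z - w) / (x * y) <= modulus (z - w).
  move=> x1 y1; rewrite ler_pdivrMr; last by rewrite mulr_gt0; lra.
  by apply: ler_peMr; rewrite ?modulus_ge0 // -[1]mulr1 ler_pM.
split; rewrite /chord.
  by rewrite [wedge _ _](_ : _ = z - w) ?H // /wedge /= mulr1 mul1r.
by rewrite [wedge _ _](_ : _ = w - z) 1?modulusB ?H // /wedge /= mulr1 mul1r.
Qed.

(** A cluster point of an ultrafilter is a limit: [G] contains either the indices landing in a given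
    ball or those landing outside, and clustering excludes the latter. *)
Lemma ultra_limit_disc (G : set_system nat) (u : nat -> C R) : UltraFilter G ->
  G [set k | modulus (u k) <= 1] ->
  exists z, forall e : R, 0 < e -> G [set k | modulus (u k - z) < e].
Proof.
move=> UG Gu; have Gd : (u @ G) (cdisc 0 1).
  by apply: (@filterS _ G _ [set k | modulus (u k) <= 1]) => // k /=; rewrite /cdisc /= subr0.
have [z [_ cz]] := @compact_cdisc R 0 1 (u @ G) _ Gd.
exists z => e e0; have [//|GC] := in_ultra_setVsetC [set k | modulus (u k - z) < e] UG.
have GC' : (u @ G) (~` cball z e) by exact: GC.
by have [w []] := cz _ _ GC' (nbhs_cball z e0).
Qed.

(** The ultrafilter selects one of two charts: z where |z| <= 1, and 1 / z elsewhere, infinity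
    included. Each takes values in the closed unit disc. *)
Lemma ultra_limit_sphere (G : set_system nat) (s : nat -> sphere R) : UltraFilter G ->
  exists x, forall e : R, 0 < e -> G [set k | half_chord (s k) x < e].
Proof.
move=> UG; pose A := [set k | if s k is Some z then modulus z <= 1 else False].
have [GA|GA] := in_ultra_setVsetC A UG.
  pose u k := if s k is Some z then z else 0.
  have [|z uz] := @ultra_limit_disc G u UG.
    by apply: filterS GA => k; rewrite /A /u /=; case: (s k).
  exists (Some z) => e e0; apply: filterS (filterI GA (uz e e0)) => k [].
  rewrite /A /u /= half_chordE; case: (s k) => [v|] // _.
  by apply: le_lt_trans; have [] := chord_affine v z.
pose u k := if s k is Some z then z^-1 else 0.
have uE k : (~` A) k -> exists2 t : C R, t != 0 & coords (s k) = (t * 1, t * u k).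
  rewrite /A /u /=; case: (s k) => [z /= /negP|_]; last first.
    by exists 1; rewrite ?oner_eq0 // mulr1 mulr0.
  rewrite -ltNge => z1; have z0 : z != 0 by rewrite -modulus_gt0; lra.
  by exists z => //; rewrite mulr1 mulfV.
have [|w uw] := @ultra_limit_disc G u UG.
  apply: filterS GA => k; rewrite /A /u /=; case: (s k) => [z /= /negP|_].
    rewrite -ltNge => z1; rewrite modulusV invf_le1 //; lra.
  by rewrite modulus0 ler01.
pose x : sphere R := if w == 0 then None else Some w^-1.
have [t t0 xE] : exists2 t : C R, t != 0 & coords x = (t * 1, t * w).
  rewrite /x; have [->|w0] := eqVneq w 0.
    by exists 1; rewrite ?oner_eq0 // mulr1 mulr0.
  by exists w^-1; rewrite ?invr_eq0 // mulr1 mulVf.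
exists x => e e0; apply: filterS (filterI GA (uw e e0)) => k [/uE[v v0 skE] /= uwe].
rewrite half_chordE skE xE (@chordZl R v (1, u k)) // chordC (@chordZl R t (1, w)) // chordC.
by apply: le_lt_trans uwe; have [] := chord_affine (u k) w.
Qed.

(** Ascoli's theorem with an ultrafilter in place of diagonal extraction: pointwise limits along [G]
    exist everywhere by compactness of the sphere, equicontinuity makes the convergence uniform on
    the disc, and a subsequence is extracted at the end. *)
Lemma normal_of_equicontinuous (F : set (C R -> sphere R)) z0 (rho : R) : 0 < rho ->
  (forall z, cdisc z0 rho z -> forall e : R, 0 < e -> exists2 delta : R, 0 < delta &
    forall f, F f -> forall w, modulus (w - z) < delta -> half_chord (f z) (f w) < e) ->
  normal_at F z0.
Proof.
move=> rho0 Feq; exists (cball z0 rho); split.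
- exact: open_cball.
- by rewrite /cball /= subrr modulus0.
move=> f Ff; have [G [UG ooG]] := @ultraFilterLemma nat \oo _.
have /choice[g gP] z : exists x, forall e : R, 0 < e -> G [set k | half_chord (f k z) x < e].
  exact: ultra_limit_sphere.
have GP : ProperFilter G by exact: ultra_proper.
have unif (e : R) : 0 < e ->
    G [set k | forall z, cdisc z0 rho z -> half_chord (f k z) (g z) < e].
  move=> e0; have e5 : 0 < e / 5 by lra.
  (* Near each centre z a single set of [G] serves all nearby points; compactness glues these local
     choices. *)
  have /compact_near_coveringP := @compact_cdisc R z0 rho.
  move=> /(_ nat G (fun k z => half_chord (f k z) (g z) < e) _); apply => z zd.
  have [delta delta0 dP] := Feq z zd _ e5.
  have Gz := gP z _ e5.
  have gg w : modulus (w - z) < delta -> half_chord (g z) (g w) < 3 * (e / 5).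
    move=> wz; have [k [/= k1 k2]] := filter_ex (filterI Gz (gP w _ e5)).
    have k3 := dP _ (Ff k) w wz.
    apply: le_lt_trans (half_chord_triangle _ (f k z) _) _; rewrite half_chordC.
    by have := half_chord_triangle (f k z) (f k w) (g w); lra.
  exists (cball z delta, [set k | half_chord (f k z) (g z) < e / 5]).
    by split => //=; exact: nbhs_cball.
  move=> [w k] [/= wz k1]; rewrite /cball /= in wz.
  have k3 := dP _ (Ff k) w wz; have k4 := gg w wz.
  apply: le_lt_trans (half_chord_triangle _ (f k z) _) _; rewrite half_chordC.
  by have := half_chord_triangle (f k z) (g z) (g w); lra.
(* Since [G] refines [\oo], each of its sets contains indices as large as desired: [c] picks one
   from [mN.2] on whose error is below 1 / (mN.1 + 1). *)
have /choice[c cP] (mN : nat * nat) : exists k, (mN.2 <= k)%N /\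
    forall z, cdisc z0 rho z -> half_chord (f k z) (g z) < mN.1.+1%:R^-1.
  have G1 : G [set k | (mN.2 <= k)%N] by apply: ooG; exists mN.2.
  have i0 : 0 < mN.1.+1%:R^-1 :> R by rewrite invr_gt0.
  by have [k [k1 k2]] := filter_ex (filterI G1 (unif _ i0)); exists k.
pose phi := fix phi m := if m is m'.+1 then c (m, (phi m').+1) else c (0, 0)%N.
exists phi; split.
  apply: homo_ltn => [y x z|m]; first exact: ltn_trans.
  by have [] := cP (m.+1, (phi m).+1).
have phiP m z : cdisc z0 rho z -> half_chord (f (phi m) z) (g z) < m.+1%:R^-1.
  by case: m => [|m]; [have [_] := cP (0, 0)%N|have [_] := cP (m.+1, (phi m).+1)]; apply.
exists g => z zU; exists setT; first exact: filterT.
move=> e e0; have [r r0 rP] := spherical_dist_lt e0.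
near=> k => w wU _; apply: rP; rewrite /= .
apply: lt_trans (phiP k w _) _; first by rewrite /cdisc /=; exact: ltW.
by near: k; exact: near_infty_natSinv_lt (PosNum r0).
Unshelve. all: by end_near. Qed.

End Ascoli.

(** * The maximum principle and the Schwarz lemma for quotients of polynomials *)

Section MaximumPrinciple.
Variable R : realType.
Implicit Types (z w : C R) (p q : {poly C R}).

(** Adding e |w - z0|^2 to |p / q|^2 makes the last coefficient of the expansion at least e > 0 off
    the zeros of p, which an interior maximum forbids. *)
Lemma maximum_principle p q z0 (r M : R) : 0 <= r -> 0 <= M ->
  (forall z, cdisc z0 r z -> q.[z] != 0) ->
  (forall z, modulus (z - z0) = r -> modulus p.[z] <= M * modulus q.[z]) ->
  forall z, cdisc z0 r z -> modulus p.[z] <= M * modulus q.[z].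
Proof.
move=> r0 M0 q0 pM z zd.
have qz : 0 < modulus q.[z] by rewrite modulus_gt0 q0.
rewrite -ler_pdivrMr // -(@ler_pXn2r _ 2) ?nnegrE ?divr_ge0 ?modulus_ge0 //.
apply/ler_addgt0Pr => e1 e10; pose e := e1 / (r ^+ 2 + 1).
have r20 : 0 <= r ^+ 2 by exact: sqr_ge0.
have e0 : 0 < e by rewrite divr_gt0 //; lra.
have er : e * r ^+ 2 <= e1.
  have -> : e1 = e * r ^+ 2 + e by rewrite /e; field; rewrite gt_eqF //; lra.
  by rewrite lerDl ltW.
pose g w := e * modulus (w - z0) ^+ 2.
pose f w := modulus p.[w] ^+ 2 / modulus q.[w] ^+ 2 + g w.
have Hg w : expansion2 g w (real_complex R e * (2 * (conjc (w - z0) : C R))) e.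
  have := expansion2Z e (expansion2_modulus_sqr ('X - z0%:P) w).
  have -> : (fun v => e * modulus ('X - z0%:P).[v] ^+ 2) = g.
    by apply/funext => v; rewrite /g !hornerE.
  rewrite derivB derivX derivC subr0 hornerC hornerXsubC modulus1 expr1n => H.
  by apply: expansion2_eq H _ _; rewrite mulr1.
have fc w : cdisc z0 r w -> {for w, continuous f}.
  move=> wd; have qw : modulus q.[w] ^+ 2 != 0 by rewrite expf_neq0 // modulus_eq0 q0.
  have H1 : modulus p.[x] ^+ 2 @[x --> w] --> modulus p.[w] ^+ 2.
    exact: expansion2_continuous (expansion2_modulus_sqr p w).
  have H2 : modulus q.[x] ^+ 2 @[x --> w] --> modulus q.[w] ^+ 2.
    exact: expansion2_continuous (expansion2_modulus_sqr q w).
  have H3 : g x @[x --> w] --> g w by exact: expansion2_continuous (Hg w).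
  exact: cvgD (cvgM H1 (cvgV qw H2)) H3.
have [zm] : exists2 c0, c0 \in cdisc z0 r & forall t, t \in cdisc z0 r -> f t <= f c0.
  apply: compact_EVT_max.
  - by exists z0; rewrite /cdisc /mkset subrr modulus0.
  - exact: compact_cdisc.
  - by apply: continuous_in_subspaceT => w; rewrite inE => /fc.
rewrite inE => zms zmax.
have fz : (modulus p.[z] / modulus q.[z]) ^+ 2 <= f z.
  by rewrite exprMn exprVn lerDl mulr_ge0 ?sqr_ge0 // ltW.
apply: le_trans fz (le_trans (zmax z _) _); first by rewrite inE.
have gm : g zm <= e1.
  apply: le_trans er; apply: ler_wpM2l; first exact: ltW.
  by apply: lerXn2r; rewrite ?nnegrE ?modulus_ge0.
suff : modulus p.[zm] ^+ 2 / modulus q.[zm] ^+ 2 <= M ^+ 2 by rewrite /f; lra.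
have qm : 0 < modulus q.[zm] by rewrite modulus_gt0 q0.
have [zmr|zmr] := eqVneq (modulus (zm - z0)) r.
  rewrite -expr_div_n; apply: lerXn2r; rewrite ?nnegrE ?divr_ge0 ?modulus_ge0 //.
  by rewrite ler_pdivrMr // pM.
have [pm|pm] := eqVneq p.[zm] 0.
  by rewrite pm modulus0 expr0n mul0r sqr_ge0.
exfalso; have zmlt : modulus (zm - z0) < r by rewrite lt_neqAle zmr.
have qm0 : q.[zm] != 0 by exact: q0.
have Hu := expansion2_expR (expansion2D (expansion2_ln_modulus pm)
  (expansion2Z (-1) (expansion2_ln_modulus qm0))).
have := expansion2_max (expansion2D Hu (Hg zm)).
have fE w : p.[w] != 0 -> q.[w] != 0 ->
  expR (ln (modulus p.[w] ^+ 2) + -1 * ln (modulus q.[w] ^+ 2)) + g w = f w.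
  move=> pw qw; rewrite mulN1r expRB !lnK ?posrE ?exprn_gt0 ?modulus_gt0 //.
set E := expR _; have E0 : 0 < E by exact: expR_gt0.
move=> H; have : E * (0 + -1 * 0) + E * modulus (2 * (p^`().[zm] / p.[zm]) +
    real_complex R (-1) * (2 * (q^`().[zm] / q.[zm]))) ^+ 2 / 4 + e <= 0.
  apply: H; have [s s0 sP] : exists2 s : R, 0 < s & forall w, modulus (w - zm) < s -> (p * q).[w] != 0.
    by apply: horner_neq0_near; rewrite hornerM mulf_neq0.
  exists (Num.min s (r - modulus (zm - z0))); first by rewrite lt_min s0 subr_gt0.
  move=> h; rewrite lt_min => /andP[hs hr].
  have := sP (zm + h); rewrite [zm + h]addrC addrK => /(_ hs).
  rewrite hornerM mulf_eq0 negb_or => /andP[ph qh].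
  rewrite (fE _ ph qh) (fE _ pm qm0); apply: zmax; rewrite inE /cdisc /=.
  by have := modulusD h (zm - z0); rewrite addrA; lra.
rewrite mulr0 addr0 mulr0 add0r => H'.
have : 0 <= E * modulus (2 * (p^`().[zm] / p.[zm]) +
    real_complex R (-1) * (2 * (q^`().[zm] / q.[zm]))) ^+ 2 / 4.
  by rewrite divr_ge0 // mulr_ge0 ?sqr_ge0 // ltW.
by lra.
Qed.

(** The maximum principle is applied to p divided by (z - z0)^m, a factor of constant modulus r^m on
    the boundary circle. *)
Lemma schwarz_order p q z0 (r M : R) m : 0 < r -> 0 <= M ->
  ('X - z0%:P) ^+ m %| p ->
  (forall z, cdisc z0 r z -> q.[z] != 0) ->
  (forall z, modulus (z - z0) = r -> modulus p.[z] <= M * modulus q.[z]) ->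
  forall z, cdisc z0 r z -> modulus p.[z] <= M * (modulus (z - z0) / r) ^+ m * modulus q.[z].
Proof.
move=> r0 M0 /dvdpP[g pE] q0 pM z zd.
have hE w : modulus p.[w] = modulus g.[w] * modulus (w - z0) ^+ m.
  by rewrite pE hornerM horner_exp !hornerE modulusM modulusX.
have rm0 : 0 < r ^+ m by exact: exprn_gt0.
have := @maximum_principle g q z0 r (M / r ^+ m) (ltW r0) _ q0 _ z zd.
rewrite divr_ge0 ?(ltW rm0) // => /(_ isT) H.
have {}H : modulus g.[z] <= M / r ^+ m * modulus q.[z].
  apply: H => w wr; rewrite mulrAC ler_pdivlMr //.
  by have := pM w wr; rewrite hE wr.
rewrite hE expr_div_n.
have -> : M * (modulus (z - z0) ^+ m / r ^+ m) * modulus q.[z] =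
  M / r ^+ m * modulus q.[z] * modulus (z - z0) ^+ m by ring.
by apply: ler_wpM2r => //; rewrite exprn_ge0 ?modulus_ge0.
Qed.

Lemma isolated_roots p z : p != 0 -> exists2 r : R, 0 < r &
  forall w, w != z -> modulus (w - z) < r -> p.[w] != 0.
Proof.
move=> p0; have [m [q qz pE]] := multiplicity_XsubC p z.
rewrite p0 /= in qz; have [r r0 rP] := horner_neq0_near qz.
exists r => // w wz wr; rewrite pE hornerM horner_exp !hornerE.
by rewrite mulf_neq0 ?expf_neq0 ?rP // subr_eq0.
Qed.

End MaximumPrinciple.

(** * Normality implies equicontinuity at the point *)

Section NormalEquicontinuous.
Variable R : realType.
Implicit Types (z w : C R).

Lemma rational_map_continuous (a b : {poly C R}) z (e : R) : coprimep a b -> 0 < e ->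
  exists2 r : R, 0 < r & forall w, modulus (w - z) < r ->
    half_chord (rational_map a b z) (rational_map a b w) < e.
Proof.
move=> ab e0; have nz : nonzero (pvalue a b z) by exact: pvalue_nonzero.
pose N := modulus a.[z] ^+ 2 + modulus b.[z] ^+ 2.
have N0 : 0 < N by rewrite /N -(pnorm_sqr (pvalue a b z)) exprn_gt0 // pnorm_gt0.
pose L := modulus (wronskian a b).[z] / N.
have L0 : 0 <= L by rewrite divr_ge0 ?modulus_ge0 // ltW.
have [|r r0 rP] := @chord_local_lipschitz R a b z L 1 nz ltr01 L0.
  by rewrite /L divfK // lt0r_neq0.
have L1 : 0 < L + 1 by lra.
exists (Num.min r (e / (L + 1))); first by rewrite lt_min r0 divr_gt0.
move=> w; rewrite lt_min => /andP[wr we].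
rewrite half_chordE chord_rational_map // chordC chord_rational_map // chordC.
by apply: le_lt_trans (rP w wr) _; rewrite mulrC -ltr_pdivlMr.
Qed.

(** Otherwise some members [fw m] of the family move by at least e at points tending to z0. A
    subsequence is uniformly close to its limit near z0, hence to one fixed member, whose continuity
    at z0 gives a contradiction. *)
Lemma equicontinuous_of_normal (F : set (C R -> sphere R)) z0 (e : R) : normal_at F z0 ->
  (forall f, F f -> forall e : R, 0 < e -> exists2 r : R, 0 < r &
     forall w, modulus (w - z0) < r -> half_chord (f z0) (f w) < e) ->
  0 < e -> exists2 r : R, 0 < r &
    forall f, F f -> forall w, modulus (w - z0) < r -> half_chord (f z0) (f w) < e.
Proof.
move=> [U [oU Uz0 HU]] Fc e0; apply: contrapT => Hno.
have /choice[fw fwP] m : exists fw : (C R -> sphere R) * C R,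
    [/\ F fw.1, modulus (fw.2 - z0) < m.+1%:R^-1 & e <= half_chord (fw.1 z0) (fw.1 fw.2)].
  apply: contrapT => Hm; apply: Hno; exists m.+1%:R^-1; first by rewrite invr_gt0.
  move=> f Ff w wz; rewrite ltNge; apply/negP => ew; apply: Hm.
  by exists (f, w).
have [|phi [phim [g gP]]] := HU (fun m => (fw m).1); first by move=> k; have [] := fwP k.
have e5 : 0 < e / 5 by lra.
have [e1 e10 e1P] := half_chord_lt e5.
have [N Nz0 NP] := gP z0 Uz0.
have [k0 _ k0P] := NP _ e10.
have unif k w : (k0 <= k)%N -> U w -> N w -> half_chord ((fw (phi k)).1 w) (g w) < e / 5.
  by move=> kk Uw Nw; apply: e1P; apply: (k0P k).
have [F0 _ _] := fwP (phi k0).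
have [r1 r10 r1P] := Fc _ F0 _ e5.
have : nbhs z0 (U `&` N `&` cball z0 r1).
  apply: filterI; last exact: nbhs_cball.
  by apply: filterI => //; exact: open_nbhs_nbhs.
move=> /nbhs_modulusP[r r0 rP].
have [k [kk kr]] : exists k, (k0 <= k)%N /\ k.+1%:R^-1 < r.
  have [k1 _ k1P] := near_infty_natSinv_lt (PosNum r0).
  exists (maxn k0 k1); split; first exact: leq_maxl.
  by apply: k1P; rewrite /= leq_maxr.
have kphi : (k <= phi k)%N.
  elim: (k) => // m IH; apply: leq_ltn_trans IH _; exact: phim.
have [Fk wk ek] := fwP (phi k).
have wr : modulus ((fw (phi k)).2 - z0) < r.
  apply: lt_trans wk _; apply: le_lt_trans kr.
  by rewrite lef_pV2 ?posrE ?ltr0n // ler_nat ltnS.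
have [[Uw Nw] Bw] := rP _ wr.
have h1 := unif k z0 kk Uz0 (nbhs_singleton Nz0).
have h2 := unif k0 z0 (leqnn _) Uz0 (nbhs_singleton Nz0).
have h3 := unif k _ kk Uw Nw; have h4 := unif k0 _ (leqnn _) Uw Nw.
have h5 := r1P _ Bw.
move: ek h1 h2 h3 h4 h5; set w := (fw (phi k)).2; set f := (fw (phi k)).1.
set f0 := (fw (phi k0)).1 => ek h1 h2 h3 h4 h5.
(* The chain f z0, g z0, f0 z0, f0 w, g w, f w has five links, each shorter than e / 5; continuity
   is asked of the fixed member [f0] only. *)
have t1 := half_chord_triangle (f z0) (g z0) (f w).
have t2 := half_chord_triangle (g z0) (f0 z0) (f w).
have t3 := half_chord_triangle (f0 z0) (f0 w) (f w).
have t4 := half_chord_triangle (f0 w) (g w) (f w).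
rewrite (half_chordC (g z0) (f0 z0)) in t2; rewrite (half_chordC (g w)) in t4.
by lra.
Qed.

End NormalEquicontinuous.

(** * The activity locus *)

Section Main.
Variables (R : realType) (d : nat).
Hypothesis d2 : (2 <= d)%N.
Implicit Types (z w : C R).

Local Notation P := (cayley_in R d).
Local Notation Q := (cayley_out R d).
Local Notation pt := (@cayley_point R d).

Let zeros := [set z : C R | exists n : nat, root (indep_poly (C R) (cayley_tree d n)) z].

Lemma zeros_cayley z : zeros z <-> exists n, (P n + Q n).[z] = 0.
Proof.
by split=> -[n zn]; exists n; [rewrite -indep_poly_cayley; apply/rootP|
  rewrite indep_poly_cayley; apply/rootP].
Qed.

Lemma chord_cayley n z w :
  half_chord (occupation_ratio (cayley_tree d n) z) (occupation_ratio (cayley_tree d n) w) =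
  chord (pt n z) (pt n w).
Proof.
have c := coprimep_cayley R d n.
by rewrite half_chordE chord_rational_map // chordC chord_rational_map // chordC.
Qed.

Lemma normal_of_not_limit_point z0 : ~ limit_point zeros z0 ->
  normal_at (range (fun n => occupation_ratio (R := R) (cayley_tree d n))) z0.
Proof.
move=> /existsNP[V /not_implyP[/nbhs_modulusP[r1 r10 r1V] noV]].
(* All the P_n vanish at 0, so the punctured disc must avoid 0 as well as the zeros of the
   independence polynomials. *)
pose r := if z0 == 0 then r1 else Num.min r1 (modulus z0).
have r0 : 0 < r by rewrite /r; case: eqVneq => // z00; rewrite lt_min r10 modulus_gt0.
have rr1 : r <= r1 by rewrite /r; case: eqP => // _; rewrite ge_min lexx.
have nz y : y != z0 -> modulus (y - z0) < r -> forall n,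
    [/\ (P n).[y] != 0, (Q n).[y] != 0 & (P n + Q n).[y] != 0].
  move=> yz yr n.
  have S m : (P m + Q m).[y] != 0.
    apply/eqP => Sm; apply: noV; exists y; split => //.
      by apply/zeros_cayley; exists m.
    by apply: r1V; exact: lt_le_trans yr rr1.
  have y0 : y != 0.
    move: yr; rewrite /r; case: (eqVneq z0 0) => [z00 _|z00]; first by rewrite -z00.
    rewrite lt_min => /andP[_]; apply: contraTneq => ->.
    by rewrite sub0r modulusN ltxx.
  have Qm m : (Q m).[y] != 0.
    case: m => [|m]; first by rewrite cayley_out0 hornerC oner_eq0.
    by rewrite cayley_outS horner_exp expf_neq0.
  split => //; case: n => [|n]; first by rewrite cayley_in0 hornerX.
  by rewrite cayley_inS hornerM hornerX horner_exp mulf_neq0 ?expf_neq0.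
have r20 : 0 < r / 2 by lra.
apply: (normal_of_equicontinuous r20) => z; rewrite /cdisc /= => zr e e0.
(* The disc about z must not contain z0, unless z0 is its centre, where [chord_equicontinuous]
   tolerates an omitted value. *)
pose s := if z == z0 then r else Num.min (modulus (z - z0)) (r / 2).
have s0 : 0 < s.
  by rewrite /s; case: eqVneq => // zz; rewrite lt_min r20 modulus_gt0 subr_eq0 zz.
have sP y : y != z -> modulus (y - z) < s -> y != z0 /\ modulus (y - z0) < r.
  rewrite /s; case: (eqVneq z z0) => [->//|zz] yz; rewrite lt_min => /andP[y1 y2].
  split; last by have := modulus_distD y z z0; lra.
  by apply: contraTneq y1 => ->; rewrite modulusB ltxx.
have [delta delta0 dP] := chord_equicontinuous s0 e0.
exists delta => // f [n _ <-] w wz.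
rewrite chord_cayley; apply: dP wz; first exact: coprimep_cayley.
by move=> y yz ys; have [y1 y2] := sP y yz ys; exact: nz.
Qed.

(** Here v represents -1. Closeness to -1 gives |u.1 + u.2| <= pnorm u / 2, so u stays away from
    infinity and its second coordinate controls the norm. *)
Lemma pnorm_near_minus_one (u v : C R * C R) : nonzero v -> v.1 + v.2 = 0 ->
  chord u v < 1 / 4 -> pnorm u <= 4 * modulus u.2.
Proof.
move=> nv v0 uv.
have v1 : v.1 = - v.2 by apply/eqP; rewrite -addr_eq0 v0.
have v2 : 0 < modulus v.2.
  rewrite modulus_gt0; apply: contraTneq nv => v2.
  by rewrite /nonzero v1 v2 oppr0 eqxx.
have [u0|u0] := eqVneq (pnorm u) 0; first by rewrite u0 mulr_ge0 ?modulus_ge0.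
have un : 0 < pnorm u by rewrite lt_def u0 pnorm_ge0.
have vn : pnorm v <= 2 * modulus v.2.
  rewrite -(@ler_pXn2r _ 2) ?nnegrE ?pnorm_ge0 ?mulr_ge0 ?modulus_ge0 //.
  rewrite pnorm_sqr v1 modulusN exprMn; have := sqr_ge0 (modulus v.2); lra.
have : modulus (wedge u v) <= 1 / 4 * (pnorm u * pnorm v).
  have uvn : 0 < pnorm u * pnorm v by rewrite mulr_gt0 // pnorm_gt0.
  by move: (ltW uv); rewrite /chord ler_pdivrMr.
have -> : wedge u v = v.2 * (u.1 + u.2) by rewrite /wedge v1; ring.
rewrite modulusM => h.
have h2 : modulus v.2 * modulus (u.1 + u.2) <= modulus v.2 * (pnorm u / 2).
  apply: le_trans h _.
  have : pnorm u * pnorm v <= pnorm u * (2 * modulus v.2) by apply: ler_wpM2l => //; exact: ltW.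
  by lra.
move: h2; rewrite ler_pM2l // => h2.
have h3 : pnorm u <= modulus u.1 + modulus u.2.
  rewrite -(@ler_pXn2r _ 2) ?nnegrE ?pnorm_ge0 ?addr_ge0 ?modulus_ge0 //.
  rewrite pnorm_sqr sqrrD.
  by have := mulr_ge0 (modulus_ge0 u.1) (modulus_ge0 u.2); lra.
have h4 : modulus u.1 <= modulus (u.1 + u.2) + modulus u.2.
  by rewrite -{1}[u.1](addrK u.2) -[modulus u.2 in X in _ <= X]modulusN modulusD.
by lra.
Qed.

Lemma chord_proportional (u u' v v' : C R * C R) :
  proportional u u' -> proportional v v' -> chord u' v' = chord u v.
Proof. by move=> [t t0 ->] [s s0 ->]; rewrite chordZl // chordC chordZl // chordC. Qed.

Lemma not_normal_of_limit_point z0 : limit_point zeros z0 ->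
  ~ normal_at (range (fun n => occupation_ratio (R := R) (cayley_tree d n))) z0.
Proof.
(* Going through z0 doubles 1/16 to 1/8, and one more detour, through mu, doubles that to the 1/4 of
   [pnorm_near_minus_one]. *)
move=> lz0 nz0; have e0 : 0 < 1 / 16 :> R by lra.
have [|rho rho0 rhoP] := equicontinuous_of_normal nz0 _ e0.
  move=> f [n _ <-] e e'0; apply: rational_map_continuous e'0; exact: coprimep_cayley.
have {}rhoP n w : modulus (w - z0) < rho -> chord (pt n z0) (pt n w) < 1 / 16.
  by move=> wr; rewrite -chord_cayley; apply: rhoP wr; exists n.
have near2 n z w : modulus (z - z0) < rho -> modulus (w - z0) < rho ->
    chord (pt n z) (pt n w) < 1 / 8.
  move=> zr wr; have h1 := rhoP n z zr; have h2 := rhoP n w wr.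
  have := chord_triangle (cayley_point_nonzero d n z) (cayley_point_nonzero d n z0)
    (cayley_point_nonzero d n w); rewrite (chordC (pt n z) (pt n z0)); lra.
have rho8 : 0 < rho / 8 by lra.
have [mu [_ /zeros_cayley[N muN] muz]] := lz0 _ (nbhs_cball z0 rho8).
(* This radius keeps the second zero nu off the finitely many parameters where the orbit of 0 has
   period N + 3. *)
have [r r0 rP] := isolated_roots z0 (@cayley_wedge0_neq0 R d d2 N.+3 isT).
have m0 : 0 < Num.min (rho / 8) r by rewrite lt_min rho8.
have [nu [nuz0 /zeros_cayley[M nuM] nuz]] := lz0 _ (nbhs_cball z0 m0).
rewrite /cball /= in muz nuz; move: nuz; rewrite lt_min => /andP[nuz nur].
have W0 := rP nu nuz0 nur.
set p := N.+3 in W0.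
pose c0 := chord (pt M nu) (pt (M + p) nu).
have c0_gt0 : 0 < c0.
  rewrite lt_def chord_ge0 andbT chord_eq0 ?cayley_point_nonzero //.
  by rewrite wedge_cayley_point (cayley_wedge_neq0 d2 nuM).
(* The Schwarz lemma will give c0 <= 16 / 2^(m+1) <= 16 / (m + 1), which this choice of [m]
   contradicts. *)
have [m mP] : exists m, m.+1%:R^-1 < c0 / 16.
  have c16 : 0 < c0 / 16 by lra.
  have [k _ kP] := near_infty_natSinv_lt (PosNum c16).
  by exists k; apply: kP => /=.
have [n0 n0P] := cayley_wedge_order d2 muN m.+1.
(* An index at least [n0] at which the orbit at nu is back at -1. *)
pose n := (M + M.+3 * n0)%N.
have nP : ('X - mu%:P) ^+ m.+1 %| cayley_wedge R d p n.
  by apply: n0P; apply: leq_trans (leq_addl _ _); exact: leq_pmull.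
have disc z : cdisc mu (rho / 2) z -> modulus (z - z0) < rho.
  by rewrite /cdisc /= => zd; have := modulus_distD z mu z0; lra.
have mud : modulus (mu - z0) < rho by lra.
have nud : modulus (nu - z0) < rho by lra.
have nun : (pt n nu).1 + (pt n nu).2 = 0.
  by have := cayley_zero_mul d2 nuM n0; rewrite hornerD.
have bound z : cdisc mu (rho / 2) z -> pnorm (pt n z) <= 4 * modulus (Q n).[z] /\
    pnorm (pt (n + p) z) <= 4 * modulus (Q (n + p)%N).[z].
  move=> /disc zd; have nzn := cayley_point_nonzero d n nu.
  split; apply: (pnorm_near_minus_one nzn nun).
    by have := near2 n z nu zd nud; lra.
  (* At mu the orbit has period p, so R_(n+p) and R_n agree there; this brings R_(n+p) close to -1
     on the whole disc too. *)
  have E : chord (pt (n + p) mu) (pt n nu) = chord (pt n mu) (pt n nu).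
    apply: chord_proportional; first exact: (cayley_periodic d2 muN n).
    by exists 1; rewrite ?oner_eq0 // !mul1r -surjective_pairing.
  have h1 := near2 (n + p)%N z mu zd mud; have h2 := near2 n mu nu mud nud.
  have := chord_triangle (cayley_point_nonzero d (n + p) z)
    (cayley_point_nonzero d (n + p) mu) nzn; rewrite E; lra.
pose q := Q n * Q (n + p)%N.
have q0 z : cdisc mu (rho / 2) z -> q.[z] != 0.
  move=> /bound[b1 b2]; rewrite hornerM -modulus_eq0 modulusM mulf_neq0 // gt_eqF //.
    by have := pnorm_gt0 (cayley_point_nonzero d n z); lra.
  by have := pnorm_gt0 (cayley_point_nonzero d (n + p) z); lra.
have pq z : cdisc mu (rho / 2) z -> modulus (cayley_wedge R d p n).[z] <= 16 * modulus q.[z].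
  move=> /bound[b1 b2]; rewrite -wedge_cayley_point modulus_wedge ?cayley_point_nonzero //.
  apply: (@le_trans _ _ (1 * (pnorm (pt n z) * pnorm (pt (n + p) z)))).
    by apply: ler_wpM2r; rewrite ?mulr_ge0 ?pnorm_ge0 // chord_le1 ?cayley_point_nonzero.
  rewrite mul1r hornerM modulusM.
  have -> : 16 * (modulus (Q n).[z] * modulus (Q (n + p)%N).[z]) =
    (4 * modulus (Q n).[z]) * (4 * modulus (Q (n + p)%N).[z]) by ring.
  by apply: ler_pM; rewrite ?pnorm_ge0.
have rho2 : 0 < rho / 2 by lra.
have numu : modulus (nu - mu) <= rho / 4.
  by have := modulus_distD nu z0 mu; rewrite (modulusB z0 mu); lra.
have nuD : cdisc mu (rho / 2) nu by rewrite /cdisc /=; lra.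
have H : modulus (cayley_wedge R d p n).[nu] <=
    16 * (modulus (nu - mu) / (rho / 2)) ^+ m.+1 * modulus q.[nu].
  apply: (schwarz_order rho2 _ nP q0) => // z zr.
  by apply: pq; rewrite /cdisc /= zr.
move: H; rewrite -wedge_cayley_point modulus_wedge ?cayley_point_nonzero //.
(* Periodicity at nu makes this chord independent of [n0], which was chosen after [c0]. *)
have -> : chord (pt n nu) (pt (n + p) nu) = c0.
  apply: chord_proportional; first exact: (cayley_periodic_mul d2 nuM M n0).
  by rewrite /n addnAC; exact: (cayley_periodic_mul d2 nuM (M + p) n0).
move=> H.
have qle : modulus q.[nu] <= pnorm (pt n nu) * pnorm (pt (n + p) nu).
  rewrite hornerM modulusM.
  have leQ (u : C R * C R) : modulus u.2 <= pnorm u.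
    rewrite -(@ler_pXn2r _ 2) ?nnegrE ?pnorm_ge0 ?modulus_ge0 // pnorm_sqr.
    by rewrite lerDr sqr_ge0.
  have h1 := leQ (pt n nu). have h2 := leQ (pt (n + p)%N nu).
  by apply: ler_pM; rewrite ?modulus_ge0.
have half : (modulus (nu - mu) / (rho / 2)) ^+ m.+1 <= m.+1%:R^-1.
  apply: (@le_trans _ _ ((1 / 2) ^+ m.+1)).
    have hh : modulus (nu - mu) / (rho / 2) <= 1 / 2 by rewrite ler_pdivrMr //; lra.
    have h0 : 0 <= modulus (nu - mu) / (rho / 2) by rewrite divr_ge0 ?modulus_ge0 // ltW.
    by apply: lerXn2r; rewrite ?nnegrE //; lra.
  rewrite div1r exprVn lef_pV2 ?posrE ?exprn_gt0 ?ltr0n //.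
  by rewrite -natrX ler_nat ltnW // ltn_expl.
have N0 : 0 < pnorm (pt n nu) * pnorm (pt (n + p) nu).
  by rewrite mulr_gt0 // pnorm_gt0 // cayley_point_nonzero.
have : c0 * (pnorm (pt n nu) * pnorm (pt (n + p) nu)) <=
   16 * m.+1%:R^-1 * (pnorm (pt n nu) * pnorm (pt (n + p) nu)).
  apply: le_trans H _; apply: ler_pM; rewrite ?modulus_ge0 ?mulr_ge0 ?exprn_ge0 //.
    by rewrite divr_ge0 ?modulus_ge0 // ltW.
  by apply: ler_wpM2l.
rewrite ler_pM2r // => c0le.
move: mP c0le; set x := m.+1%:R^-1 => mP c0le; lra.
Qed.

End Main.

Theorem proposition7p1 (R : realType) (d : nat) (hd : (2 <= d)%N) :
  activity_locus R (cayley_tree d) =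
  limit_point [set z : C R | exists n : nat,
                 root (indep_poly (C R) (cayley_tree d n)) z].
Proof.
apply/seteqP; split => z.
  by move=> nz; apply: contrapT => lz; apply: nz; exact: normal_of_not_limit_point.
exact: not_normal_of_limit_point.
Qed.
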